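(* Let $R$ be a $\pi$-adically complete discrete valuation ring equipped with a $\pi$-derivation $\delta$, let $X$ be a $\pi$-formal scheme over $\operatorname{Spf} R$ with a marked point $P_0:\operatorname{Spf}R\to X$, and let $m\ge0$. Then for all $n\geq 1$, $$N^{[m]n}X\simeq J^{n-1}\big(N^{[m]1}X\big).$$ In particular, $(N^{[m]n}X)_{n\ge1}$ is the canonical prolongation sequence attached to the $\pi$-formal scheme $N^{[m]1}X$.
   Context: Let $p$ be a prime, $\mathcal{O}$ a Dedekind domain, $\mathfrak{p}$ a nonzero prime of $\mathcal{O}$ with residue field of cardinality $q$, and $\pi$ a generator of $\mathfrak{p}\mathcal{O}_{\mathfrak{p}}$. A $\pi$-derivation on an $\mathcal{O}$-algebra $R$ is a map $\delta:R\to R$ with $\delta(x+y)=\delta x+\delta y+C_\pi(x,y)$, $\delta(xy)=x^q\delta y+y^q\delta x+\pi\delta x\delta y$, where $C_\pi(X,Y)=(X^q+Y^q-(X+Y)^q)/\pi$ (if $\mathrm{char}\,\mathcal{O}=0$; $C_\pi=0$ otherwise); $\phi(x)=x^q+\pi\delta x$. $W_n(B)$ denotes the $\pi$-typical Witt vectors of length $n+1$ (ghost components $w_k=x_0^{q^k}+\pi x_1^{q^{k-1}}+\dots+\pi^kx_k$), made into an $R$-algebra via $\exp_\delta:R\to W_n(R)$, the ring homomorphism with ghost components $(r,\phi(r),\dots,\phi^n(r))$. For a $\pi$-formal scheme $Y$ over $\operatorname{Spf}R$, $J^nY$ denotes its $n$-th arithmetic jet space (Buium), the $\pi$-formal scheme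 over $\operatorname{Spf}R$ whose points in a $\pi$-adically complete $R$-algebra $B$ are $Y(W_n(B))$; it comes with projections $J^{n+1}Y\to J^nY$ (from truncation) and Frobenius lifts $\phi_Y:J^{n+1}Y\to J^nY$, and $(J^nY)_{n\ge0}$ is the canonical prolongation sequence of $Y$. Let $P_m:\operatorname{Spf}R\to J^mX$ be induced by $P_0$ and $\exp_\delta$, and $N^{[m]n}X:=J^{m+n}X\times_{J^mX,P_m}\operatorname{Spf}R$.
   Formalization: The formal theorem assumes in addition that the Frobenius lift fixes π, i.e. φ(π)=π (φ is O-linear on π); without it exp_δ may not exist, or, e.g. for δ=0 in equal characteristic, the isomorphism can fail. *)

(* Defs.v *)
From HB Require Import structures.
From mathcomp Require Import all_boot all_algebra.
From mathcomp Require Import boolp classical_sets.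
From mathcomp Require Import mpoly zify ring.

Set Implicit Arguments.
Unset Strict Implicit.
Unset Printing Implicit Defensive.

Import GRing.Theory.
Local Open Scope ring_scope.

Definition is_ideal (A : comPzRingType) (I : set A) : Prop :=
  [/\ I 0, forall x y, I x -> I y -> I (x + y) & forall a x, I x -> I (a * x)].

Definition ideal_gen (A : comPzRingType) (E : set A) (x : A) : Prop :=
  exists s : seq (A * A),
    (forall c, c \in s -> E c.2) /\ x = \sum_(c <- s) c.1 * c.2.

Definition noetherian (A : comPzRingType) : Prop :=
  forall I : set A, is_ideal I ->
    exists s : seq A, forall x, I x <-> ideal_gen [set y | y \in s] x.

Definition maximal_ideal (A : comPzRingType) (I : set A) : Prop :=
  [/\ is_ideal I, ~ I 1 &
      forall J : set A, is_ideal J -> (forall x, I x -> J x) -> ~ J 1 ->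
        forall x, J x -> I x].

Definition integrally_closed (A : idomainType) : Prop :=
  forall x : {fraction A},
    integralOver (@tofrac A) x -> exists a : A, x = tofrac a.

Definition dedekind (A : idomainType) : Prop :=
  [/\ noetherian A, integrally_closed A &
      forall P : prime_idealr A,
        (exists2 x, x \in P & x != 0) -> maximal_ideal [set x | x \in P]].

Definition dvr (A : idomainType) : Prop :=
  exists t : A, [/\ t != 0, t \isn't a GRing.unit &
    forall x : A, x != 0 ->
      exists u k, u \is a GRing.unit /\ x = u * t ^+ k].

Definition congr_mod (A : comPzRingType) (d x y : A) : Prop :=
  exists z, x - y = d * z.

(* The map from A to the limit of the A / d^k is injective and surjective. *)
Definition adically_complete (A : comPzRingType) (d : A) : Prop :=
  (forall x, (forall k, congr_mod (d ^+ k) x 0) -> x = 0) /\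
  (forall u : nat -> A, (forall k, congr_mod (d ^+ k) (u k.+1) (u k)) ->
     exists l, forall k, congr_mod (d ^+ k) l (u k)).

(* The generator pi of the maximal ideal of the localization at primeP is
   pi_num / pi_den, in the fraction field of ringO. *)
Record base_prime := BasePrime {
  ringO : idomainType;
  ringO_dedekind : dedekind ringO;
  primeP : prime_idealr ringO;
  primeP_neq0 : exists2 x, x \in primeP & x != 0;
  res_char : nat;
  res_char_prime : prime res_char;
  res_charP : res_char%:R \in primeP;
  res_deg : nat;
  res_deg_gt0 : (0 < res_deg)%N;
  primeP_residue : exists f : 'I_(res_char ^ res_deg) -> {ideal_quot primeP}, bijective f;
  pi_num : ringO;
  pi_den : ringO;
  pi_denP : pi_den \notin primeP;
  pi_numP : pi_num \in primeP;
  pi_gen : forall x, x \in primeP -> exists a s, s \notin primeP /\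
    tofrac x = (tofrac a / tofrac s) * (tofrac pi_num / tofrac pi_den)
      :> {fraction ringO}
}.

Definition res_card (K : base_prime) : nat := (res_char K ^ res_deg K)%N.

(* The value of C_pi in R: since pi is nonzero in the domain R, the division
   by pi can be made in the fraction field of R. *)
Definition C_pi (O R : idomainType) (q : nat) (w x y : R) : {fraction R} :=
  if `[< [pchar O] =i pred0 >]
  then tofrac (x ^+ q + y ^+ q - (x + y) ^+ q) / tofrac w
  else 0.

(* The O-algebra dR is given by dstr; by dstr_loc it is an algebra over the
   localization of O at primeP, so that pi acts on it (as dpi).  By delta_pi
   the Frobenius lift x^q + pi delta(x) fixes pi, as does any map of
   O-algebras; otherwise exp_delta would not be compatible with the action
   of pi on Witt vectors. *)
Record delta_dvr (K : base_prime) := DeltaDVR {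
  dR : idomainType;
  dR_dvr : dvr dR;
  dstr : {rmorphism ringO K -> dR};
  dstr_loc : forall s, s \notin primeP K -> dstr s \is a GRing.unit;
  dpi : dR := dstr (pi_num K) / dstr (pi_den K);
  dpi_neq0 : dpi != 0;
  dR_complete : adically_complete dpi;
  delta : dR -> dR;
  deltaD : forall x y, tofrac (delta (x + y)) =
    tofrac (delta x) + tofrac (delta y) + C_pi (ringO K) (res_card K) dpi x y;
  deltaM : forall x y, delta (x * y) =
    x ^+ res_card K * delta y + y ^+ res_card K * delta x + dpi * delta x * delta y;
  delta_pi : dpi ^+ res_card K + dpi * delta dpi = dpi
}.

Definition dphi (K : base_prime) (S : delta_dvr K) (x : dR S) : dR S :=
  x ^+ res_card K + dpi S * delta x.

Section Congruences.
Variable A : comPzRingType.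
Implicit Types d x y z : A.

Lemma congr_refl d x : congr_mod d x x.
Proof. by exists 0; rewrite subrr mulr0. Qed.

Lemma congr_eq d x y : x = y -> congr_mod d x y.
Proof. by move=> ->; apply: congr_refl. Qed.

Lemma congr_sym d x y : congr_mod d x y -> congr_mod d y x.
Proof. by case=> z e; exists (- z); rewrite mulrN -e opprB. Qed.

Lemma congr_trans d y x z :
  congr_mod d x y -> congr_mod d y z -> congr_mod d x z.
Proof.
by case=> a ea [b eb]; exists (a + b); rewrite mulrDr -ea -eb addrA subrK.
Qed.

Lemma congrD d x y x' y' :
  congr_mod d x x' -> congr_mod d y y' -> congr_mod d (x + y) (x' + y').
Proof.
by case=> a ea [b eb]; exists (a + b); rewrite mulrDr -ea -eb opprD addrACA.
Qed.

Lemma congrN d x x' : congr_mod d x x' -> congr_mod d (- x) (- x').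
Proof. by case=> a ea; exists (- a); rewrite mulrN -ea opprD. Qed.

Lemma congrM d x y x' y' :
  congr_mod d x x' -> congr_mod d y y' -> congr_mod d (x * y) (x' * y').
Proof.
case=> a ea [b eb]; exists (a * y + x' * b).
by rewrite mulrDr mulrA -ea mulrCA -eb mulrBl mulrBr addrA subrK.
Qed.

Lemma congrX d x x' n : congr_mod d x x' -> congr_mod d (x ^+ n) (x' ^+ n).
Proof.
move=> h; elim: n => [|n IH]; first exact: congr_refl.
by rewrite !exprS; apply: congrM.
Qed.

Lemma congr_sum d (I : Type) (r : seq I) (P : pred I) (F G : I -> A) :
  (forall i, P i -> congr_mod d (F i) (G i)) ->
  congr_mod d (\sum_(i <- r | P i) F i) (\sum_(i <- r | P i) G i).
Proof.
move=> h; apply: (big_ind2 (congr_mod d)) => //; first exact: congr_refl.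
by move=> *; apply: congrD.
Qed.

Lemma congr_sum0 d (I : Type) (r : seq I) (P : pred I) (F : I -> A) :
  (forall i, P i -> congr_mod d (F i) 0) ->
  congr_mod d (\sum_(i <- r | P i) F i) 0.
Proof.
move=> h; elim/big_ind: _ => //; first exact: congr_refl.
by move=> x y hx hy; rewrite -[0]addr0; apply: congrD.
Qed.

Lemma congr_dvd d e x y : congr_mod (d * e) x y -> congr_mod d x y.
Proof. by case=> z e'; exists (e * z); rewrite mulrA. Qed.

Lemma congr_le d i j x y :
  (i <= j)%N -> congr_mod (d ^+ j) x y -> congr_mod (d ^+ i) x y.
Proof. by move=> /subnK <-; rewrite addnC exprD; apply: congr_dvd. Qed.

Lemma congr_scale e d x y :
  congr_mod d x y -> congr_mod (e * d) (e * x) (e * y).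
Proof. by case=> z e'; exists z; rewrite -mulrBr e' mulrA. Qed.

Lemma congr_mul0 d z : congr_mod d (d * z) 0.
Proof. by exists z; rewrite subr0. Qed.

Lemma congr_expq d q k x y : congr_mod d q%:R 0 -> (0 < k)%N ->
  congr_mod (d ^+ k) x y -> congr_mod (d ^+ k.+1) (x ^+ q) (y ^+ q).
Proof.
move=> [c ec] k0 [z ez]; rewrite subr0 in ec.
have ->: x = y + d ^+ k * z by rewrite -ez addrC subrK.
case: q ec => [|q] ec; first by apply: congr_eq; rewrite !expr0.
rewrite exprDn big_ord_recl /= subn0 expr0 mulr1 bin0 mulr1n.
rewrite -[X in congr_mod _ _ X]addr0; apply: congrD; first exact: congr_refl.
rewrite big_ord_recl /=; rewrite -[X in congr_mod _ _ X]addr0.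
apply: congrD.
  rewrite /bump /= add1n expr1 bin1 -mulr_natr ec.
  exists (y ^+ (q.+1 - 1) * z * c); rewrite subr0 exprS; ring.
apply: congr_sum0 => i _; apply: (@congr_le _ _ (k * i.+2)).
  by rewrite mulnS mulnS; lia.
rewrite /bump /= !add1n exprMn -exprM -mulr_natr mulrCA -!mulrA.
by apply: congr_mul0.
Qed.

Lemma congr_expq_iter d q k n x y : congr_mod d q%:R 0 ->
  (0 < k)%N -> congr_mod (d ^+ k) x y ->
  congr_mod (d ^+ (k + n)) (x ^+ (q ^ n)) (y ^+ (q ^ n)).
Proof.
move=> hq; elim: n k x y => [|n IH] k x y k0 h.
  by rewrite addn0 expn0 !expr1.
rewrite expnS !exprM -addSnnS; apply: IH => //; exact: congr_expq.
Qed.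

Lemma congr_prime_exp d p x y : prime p -> congr_mod d p%:R 0 ->
  congr_mod d ((x + y) ^+ p) (x ^+ p + y ^+ p).
Proof.
move=> pp [c]; rewrite subr0 => ec; have p0 := prime_gt0 pp.
rewrite exprDn; case: p pp ec p0 => // p pp ec _.
rewrite big_ord_recl big_ord_recr /= subn0 expr0 mulr1 bin0 mulr1n.
rewrite /bump /= add1n subnn expr0 mul1r binn mulr1n.
apply: congrD; first exact: congr_refl.
rewrite -[X in congr_mod _ _ X]add0r; apply: congrD; last exact: congr_refl.
apply: congr_sum0 => i _; rewrite add1n.
have /dvdnP[m ->] : (p.+1 %| 'C(p.+1, i.+1))%N.
  by apply: prime_dvd_bin => //=; rewrite ltnS ltn_ord.
rewrite -mulr_natr natrM ec; set a := (X in congr_mod _ (X * _)).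
by exists (a * (m%:R * c)); rewrite subr0; ring.
Qed.

Lemma congr_frob_add d p h x y : prime p -> congr_mod d p%:R 0 ->
  congr_mod d ((x + y) ^+ (p ^ h)) (x ^+ (p ^ h) + y ^+ (p ^ h)).
Proof.
move=> pp hp; elim: h => [|h IH]; first by rewrite !expr1; apply: congr_refl.
rewrite expnSr !exprM; apply: congr_trans (congr_prime_exp _ _ pp hp).
exact: congrX.
Qed.

End Congruences.

Section Base.
Variables (K : base_prime) (S : delta_dvr K).
Local Notation R := (dR S).
Local Notation w := (dpi S).
Local Notation q := (res_card K).

Lemma dpi_congr_p : congr_mod w (res_char K)%:R 0.
Proof.
have [a [s [sP]]] := pi_gen (res_charP K).
have s0 : s != 0 by apply: contraNneq sP => ->; exact: idealr0.
have d0 : pi_den K != 0.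
  by apply: contraNneq (pi_denP K) => ->; exact: idealr0.
move=> e; have {}e : (res_char K)%:R * (s * pi_den K) = a * pi_num K.
  apply/eqP; rewrite -tofrac_eq !tofracM e; apply/eqP.
  have ts : tofrac s != 0 by rewrite tofrac_eq0.
  have td : tofrac (pi_den K) != 0 by rewrite tofrac_eq0.
  by rewrite mulf_div divfK // mulf_neq0.
have us := dstr_loc S sP; have ud := dstr_loc S (pi_denP K).
exists (dstr S a / dstr S s); rewrite subr0 /dpi.
move/(congr1 (dstr S)): e; rewrite !rmorphM rmorph_nat => e.
apply: (mulIr us); apply: (mulIr ud); rewrite -mulrA e.
set A := dstr S a; set N := dstr S _; set s' := dstr S s.
set d := dstr S (pi_den K); transitivity (A * N * (s' / s') * (d / d)).
  by rewrite !divrr // !mulr1.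
by ring.
Qed.

Lemma dpi_congr_q : congr_mod w q%:R 0.
Proof.
rewrite /res_card natrX; have := res_deg_gt0 K; case: (res_deg K) => // h _.
by rewrite exprS -[0](mul0r ((res_char K)%:R ^+ h)); apply: congrM (congr_refl _ _);
  exact: dpi_congr_p.
Qed.

Lemma dphi_congr x : congr_mod w (dphi x) (x ^+ q).
Proof. by exists (delta x); rewrite /dphi addrC addKr. Qed.

Lemma q_gt0 : (0 < q)%N.
Proof. by rewrite expn_gt0 prime_gt0 ?res_char_prime. Qed.

Lemma pchar_expD (x y : R) : ~ ([pchar ringO K] =i pred0) ->
  (x + y) ^+ q = x ^+ q + y ^+ q.
Proof.
move=> h; have [l lc] : exists l, l \in [pchar ringO K].
  apply: contrapT => hn; apply: h => l; apply/negbTE/negP => hl.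
  by apply: hn; exists l.
have pl : l = res_char K.
  apply/eqP/negPn/negP => ne.
  have cp : coprime l (res_char K).
    by rewrite prime_coprime ?(pcharf_prime lc) // dvdn_prime2 ?res_char_prime //
      (pcharf_prime lc).
  have := res_charP K; case: (egcdnP (res_char K) (prime_gt0 (pcharf_prime lc))).
  move=> u v e _ hp; move: e; rewrite (eqP cp) => /(congr1 (fun n => n%:R : ringO K)).
  rewrite natrD !natrM (pcharf0 lc) mulr0 => e.
  have : v%:R * (res_char K)%:R + 1 \in primeP K by rewrite -e; exact: idealr0.
  have hv : v%:R * (res_char K)%:R \in primeP K by exact: idealMr.
  move=> h1; have := rpredB h1 hv; rewrite addrC addKr => h2.
  by move: h2; rewrite idealr1.
have pR : res_char K \in [pchar R].
  rewrite inE res_char_prime /=; move: (pcharf0 lc); rewrite pl => /(congr1 (dstr S)).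
  by rewrite rmorph_nat rmorph0 => ->.
rewrite exprDn_pchar // /pnat q_gt0 /=; apply/allP => r.
rewrite mem_primes => /and3P[pr _ dr].
have: (r %| res_char K)%N by move: dr; rewrite Euclid_dvdX // => /andP[].
by rewrite dvdn_prime2 ?res_char_prime // => /eqP ->.
Qed.

Lemma dpi_deltaD x y :
  w * delta (x + y) + (x + y) ^+ q =
  w * delta x + w * delta y + (x ^+ q + y ^+ q) :> R.
Proof.
have := deltaD x y; rewrite /C_pi; case: asboolP => [_|h].
  move/(congr1 (fun z => tofrac w * z)); rewrite !mulrDr.
  rewrite mulrCA divff ?mulr1; last by rewrite tofrac_eq0 dpi_neq0.
  rewrite -!tofracM -!tofracD => /eqP; rewrite tofrac_eq => /eqP ->.
  by rewrite -!addrA; do 2!congr (_ + _); ring.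
rewrite addr0 -tofracD => /eqP; rewrite tofrac_eq => /eqP ->.
by rewrite mulrDr (pchar_expD _ _ h).
Qed.

Lemma dphiD x y : dphi (x + y) = dphi x + dphi y :> R.
Proof. by rewrite /dphi addrC dpi_deltaD; ring. Qed.

Lemma dphiM x y : dphi (x * y) = dphi x * dphi y :> R.
Proof. by rewrite /dphi deltaM exprMn; ring. Qed.

Lemma dphi0 : dphi 0 = 0 :> R.
Proof. by apply: (addrI (dphi 0)); rewrite -dphiD !addr0. Qed.

Lemma dphi_pi : dphi w = w.
Proof. exact: delta_pi. Qed.

Lemma dphi1 : dphi 1 = 1 :> R.
Proof.
apply: (mulfI (dpi_neq0 S)); rewrite mulr1.
by rewrite -[X in X * _]dphi_pi -dphiM mulr1 dphi_pi.
Qed.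

Lemma dphi_is_zmod : zmod_morphism (@dphi K S).
Proof.
move=> x y; apply: (addIr (dphi y)); rewrite subrK -dphiD.
by rewrite subrK.
Qed.

Lemma dphi_is_monoid : monoid_morphism (@dphi K S).
Proof. by split; [exact: dphi1 | exact: dphiM]. Qed.

HB.instance Definition _ :=
  GRing.isZmodMorphism.Build R R (@dphi K S) dphi_is_zmod.
HB.instance Definition _ :=
  GRing.isMonoidMorphism.Build R R (@dphi K S) dphi_is_monoid.

Record ralg := RAlg {
  car :> comPzRingType;
  str : {rmorphism R -> car}
}.

Definition wpi (B : ralg) : B := str B w.

Record rhom (B C : ralg) := RHom {
  rhom_fun :> {rmorphism B -> C};
  rhom_str : forall r, rhom_fun (str B r) = str C r
}.

Lemma rhom_ext (B C : ralg) (f g : rhom B C) : f =1 g -> f = g.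
Proof.
case: f g => [f hf] [g hg] /= fg.
have e : f = g.
  case: f g {hf hg} fg => [f [[a] [b]]] [g [[a'] [b']]] /= /funext fg.
  move: fg a b a' b' => -> a b a' b'.
  by rewrite (Prop_irrelevance a a') (Prop_irrelevance b b').
by move: e hf hg => -> hf hg; rewrite (Prop_irrelevance hf hg).
Qed.

End Base.

Section Ghost.
Variables (K : base_prime) (S : delta_dvr K).
Local Notation R := (dR S).
Local Notation w := (dpi S).
Local Notation q := (res_card K).

Definition ghost (B : ralg S) (x : nat -> B) (k : nat) : B :=
  \sum_(i < k.+1) wpi B ^+ i * x i ^+ (q ^ (k - i)).

Lemma eq_ghost (B : ralg S) (x y : nat -> B) k :
  (forall i, (i <= k)%N -> x i = y i) -> ghost x k = ghost y k.
Proof. by move=> h; apply: eq_bigr => i _; rewrite h // -ltnS. Qed.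

Lemma ghostS (B : ralg S) (x : nat -> B) k :
  ghost x k.+1 = ghost (fun i => x i ^+ q) k + wpi B ^+ k.+1 * x k.+1.
Proof.
rewrite /ghost big_ord_recr /= subnn expn0 expr1; congr (_ + _).
apply: eq_bigr => i _; rewrite -exprM -expnS subSn //; by rewrite -ltnS.
Qed.

Lemma ghostr (B : ralg S) (x : nat -> B) k :
  ghost x k = \sum_(i < k) wpi B ^+ i * x i ^+ (q ^ (k - i))
              + wpi B ^+ k * x k.
Proof. by rewrite /ghost big_ord_recr /= subnn expn0 expr1. Qed.

Lemma ghost_hom (B C : ralg S) (f : {rmorphism B -> C}) (x : nat -> B) k :
  f (wpi B) = wpi C -> f (ghost x k) = ghost (fun i => f (x i)) k.
Proof.
move=> hw; rewrite rmorph_sum; apply: eq_bigr => i _.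
by rewrite rmorphM !rmorphXn hw.
Qed.

Lemma rhom_wpi (B C : ralg S) (f : rhom B C) : f (wpi B) = wpi C.
Proof. exact: rhom_str. Qed.

Definition torsion_free (B : ralg S) : Prop :=
  forall x : B, wpi B * x = 0 -> x = 0.

Lemma torsion_freeX (B : ralg S) k (x y : B) : torsion_free B ->
  wpi B ^+ k * x = wpi B ^+ k * y -> x = y.
Proof.
move=> tf /eqP; rewrite -subr_eq0 -mulrBr => /eqP.
elim: k => [|k IH]; last by rewrite exprS -mulrA => /tf.
by rewrite mul1r => /eqP; rewrite subr_eq0 => /eqP.
Qed.

Lemma ghost_inj (B : ralg S) n (x y : nat -> B) : torsion_free B ->
  (forall k, (k <= n)%N -> ghost x k = ghost y k) ->
  forall k, (k <= n)%N -> x k = y k.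
Proof.
move=> tf h k; elim/ltn_ind: k => k IH kn.
move: (h k kn); rewrite !ghostr.
rewrite (eq_bigr (fun i : 'I_k => wpi B ^+ i * y i ^+ (q ^ (k - i)))).
  by move/addrI/torsion_freeX; apply.
by move=> i _; rewrite IH // (leq_trans (ltnW (ltn_ord i))).
Qed.

Lemma wpi_congr_q (B : ralg S) : congr_mod (wpi B) q%:R 0.
Proof.
have [z] := dpi_congr_q S; rewrite subr0 => e.
by exists (str B z); rewrite subr0 -rmorphM -e rmorph_nat.
Qed.

Lemma wpi_congr_p (B : ralg S) : congr_mod (wpi B) (res_char K)%:R 0.
Proof.
have [z] := dpi_congr_p S; rewrite subr0 => e.
by exists (str B z); rewrite subr0 -rmorphM -e rmorph_nat.
Qed.

Definition frob_lift (A : ralg S) (F : {rmorphism A -> A}) : Prop :=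
  F (wpi A) = wpi A /\ forall a, congr_mod (wpi A) (F a) (a ^+ q).

Lemma ghost_congr (A : ralg S) (F : {rmorphism A -> A}) (x : nat -> A) k :
  frob_lift F ->
  congr_mod (wpi A ^+ k.+1) (ghost x k.+1) (F (ghost x k)).
Proof.
case=> hw hF; rewrite (ghost_hom _ _ hw) ghostS.
rewrite -[X in congr_mod _ _ X]addr0; apply: congrD; last exact: congr_mul0.
apply: congr_sum => i _.
have e : (i + (1 + (k - i)))%N = k.+1 by rewrite addnCA subnKC // -ltnS.
rewrite -[in X in congr_mod X]e exprD; apply: congr_scale; apply: congr_expq_iter => //.
  exact: wpi_congr_q.
by rewrite expr1; apply: congr_sym.
Qed.

Lemma dwork (A : ralg S) (F : {rmorphism A -> A}) (g : nat -> A) n :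
  frob_lift F ->
  (forall k, (k < n)%N -> congr_mod (wpi A ^+ k.+1) (g k.+1) (F (g k))) ->
  exists x : nat -> A, forall k, (k <= n)%N -> ghost x k = g k.
Proof.
move=> hF; elim: n => [|n IH] h.
  exists (fun=> g 0%N) => k; rewrite leqn0 => /eqP ->.
  by rewrite /ghost big_ord_recl big_ord0 addr0 mul1r expr1.
have [x hx] := IH (fun k kn => h k (leqW kn)).
have := h n (ltnSn n); rewrite -(hx n (leqnn n)) => /congr_sym hc.
have [z ez] := congr_trans (ghost_congr x n hF) hc.
exists (fun i => if i == n.+1 then x n.+1 - z else x i) => k.
rewrite leq_eqVlt => /predU1P[->|kn]; last first.
  rewrite -hx //; apply: eq_ghost => i ik.
  by rewrite ltn_eqF // (leq_ltn_trans ik).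
move/eqP: ez; rewrite subr_eq => /eqP; rewrite ghostr => ez.
rewrite ghostr eqxx mulrBr.
transitivity (wpi A ^+ n.+1 * z + g n.+1 - wpi A ^+ n.+1 * z).
  rewrite -ez addrA; congr (_ + _ - _); apply: eq_bigr => i _.
  by rewrite ltn_eqF.
by rewrite addrC addKr.
Qed.

Definition mev (B : ralg S) N (v : 'I_N -> B) (P : {mpoly R[N]}) : B :=
  \sum_(m <- msupp P) str B P@_m * \prod_(i < N) v i ^+ m i.

(* mmap needs a nontrivial target; B * R is one. *)
Section MevMorphism.
Variables (B : ralg S) (N : nat) (v : 'I_N -> B).

Definition aug : Type := (B * R)%type.
HB.instance Definition _ := GRing.ComPzRing.on aug.
Lemma aug_neq0 : (1 : aug) != 0.
Proof. by apply/eqP => -[_ /eqP]; rewrite oner_eq0. Qed.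
HB.instance Definition _ := GRing.PzSemiRing_isNonZero.Build aug aug_neq0.

Definition aug_str (r : R) : aug := (str B r, r).
Lemma aug_str_zmod : zmod_morphism aug_str.
Proof. by move=> x y; rewrite /aug_str rmorphB. Qed.
Lemma aug_str_monoid : monoid_morphism aug_str.
Proof. by split=> [|x y]; rewrite /aug_str ?rmorph1 ?rmorphM. Qed.
HB.instance Definition _ := GRing.isZmodMorphism.Build R aug aug_str aug_str_zmod.
HB.instance Definition _ :=
  GRing.isMonoidMorphism.Build R aug aug_str aug_str_monoid.

Definition aug_fst (x : aug) : B := x.1.
Lemma aug_fst_zmod : zmod_morphism aug_fst. Proof. by []. Qed.
Lemma aug_fst_monoid : monoid_morphism aug_fst. Proof. by []. Qed.
HB.instance Definition _ := GRing.isZmodMorphism.Build aug B aug_fst aug_fst_zmod.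
HB.instance Definition _ :=
  GRing.isMonoidMorphism.Build aug B aug_fst aug_fst_monoid.

Lemma mev_mmap P : mev v P = aug_fst (mmap aug_str (fun i => (v i, 0)) P).
Proof.
rewrite rmorph_sum; apply: eq_bigr => m _; rewrite rmorphM; congr (_ * _).
by rewrite rmorph_prod; apply: eq_bigr => i _; rewrite rmorphXn.
Qed.

Lemma mev_zmod : zmod_morphism (mev v).
Proof. by move=> x y; rewrite !mev_mmap !raddfB. Qed.
Lemma mev_monoid : monoid_morphism (mev v).
Proof. by split=> [|x y]; rewrite !mev_mmap ?rmorph1 ?rmorphM. Qed.
HB.instance Definition _ :=
  GRing.isZmodMorphism.Build {mpoly R[N]} B (mev v) mev_zmod.
HB.instance Definition _ :=
  GRing.isMonoidMorphism.Build {mpoly R[N]} B (mev v) mev_monoid.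

Lemma mevC r : mev v r%:MP = str B r.
Proof. by rewrite mev_mmap mmapC. Qed.

Lemma mevX i : mev v 'X_i = v i.
Proof. by rewrite mev_mmap mmapX mmap1U. Qed.

End MevMorphism.

Definition mpoly_ralg N : ralg S :=
  RAlg (@mpolyC N R : {rmorphism R -> {mpoly R[N]}}).

Definition mev_rhom (B : ralg S) N (v : 'I_N -> B) : rhom (mpoly_ralg N) B :=
  @RHom K S (mpoly_ralg N) B (mev v) (mevC v).

Lemma rhom_mev (B C : ralg S) (f : rhom B C) N (v : 'I_N -> B) P :
  f (mev v P) = mev (fun i => f (v i)) P.
Proof.
rewrite rmorph_sum; apply: eq_bigr => m _; rewrite rmorphM rhom_str.
by congr (_ * _); rewrite rmorph_prod; apply: eq_bigr => i _; rewrite rmorphXn.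
Qed.

Lemma mev_congr (B : ralg S) d N (v v' : 'I_N -> B) P :
  (forall i, congr_mod d (v i) (v' i)) -> congr_mod d (mev v P) (mev v' P).
Proof.
move=> h; apply: congr_sum => m _; apply: congrM; first exact: congr_refl.
apply: (big_ind2 (congr_mod d)); first exact: congr_refl.
  by move=> *; apply: congrM.
by move=> i _; apply: congrX.
Qed.

Lemma mpoly_tf N : torsion_free (mpoly_ralg N).
Proof.
move=> x; rewrite /wpi /= => /eqP; rewrite mulf_eq0 => /orP[|/eqP //].
by rewrite mpolyC_eq0 (negPf (dpi_neq0 S)).
Qed.

Lemma base_tf : torsion_free (RAlg (idfun : {rmorphism R -> R})).
Proof.
move=> x; rewrite /wpi /= => /eqP; rewrite mulf_eq0 => /orP[|/eqP //].
by rewrite (negPf (dpi_neq0 S)).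
Qed.

Definition mpoly_frob N : {mpoly R[N]} -> {mpoly R[N]} :=
  mmap (@mpolyC N R \o @dphi K S) (fun i => 'X_i ^+ q).
HB.instance Definition _ N := GRing.RMorphism.on (@mpoly_frob N).

Lemma mpoly_frobP N :
  @frob_lift (mpoly_ralg N) (@mpoly_frob N : {rmorphism _ -> _}).
Proof.
split; first by rewrite /wpi /= /mpoly_frob mmapC /= dphi_pi.
elim/mpolyind => [|c m P mP c0 IH].
  by apply: congr_eq; rewrite rmorph0 expr0n gtn_eqF // q_gt0.
rewrite rmorphD; apply: congr_trans (congr_sym _); last first.
  by apply: congr_frob_add; [exact: res_char_prime | exact: wpi_congr_p].
apply: congrD; last exact: IH.
rewrite -mul_mpolyC rmorphM exprMn; apply: congrM.
  rewrite /= /mpoly_frob mmapC /=; have [z ez] := dphi_congr c.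
  by exists z%:MP; rewrite /wpi /= -mpolyCM -ez rmorphB rmorphXn.
apply: congr_eq; rewrite /= /mpoly_frob mmapX /mmap1.
rewrite mpolyXE_id -prodrXl; apply: eq_bigr => i _.
by rewrite -!exprM mulnC.
Qed.

End Ghost.

Section Witt.
Variables (K : base_prime) (S : delta_dvr K).
Local Notation R := (dR S).
Local Notation w := (dpi S).
Local Notation q := (res_card K).

Section Universal.
Variable n : nat.

Section Pair.
Let N := (n.+1 + n.+1)%N.
Let X (i : nat) : {mpoly R[N]} := 'X_(lshift n.+1 (inord i : 'I_n.+1)).
Let Y (i : nat) : {mpoly R[N]} := 'X_(rshift n.+1 (inord i : 'I_n.+1)).
Local Notation A := (mpoly_ralg S N).

Lemma wadd_poly_ex : exists s : nat -> A, forall k, (k <= n)%N ->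
  ghost s k = ghost (X : nat -> A) k + ghost (Y : nat -> A) k.
Proof.
have hF := mpoly_frobP S N; apply: (dwork hF) => k _.
by rewrite rmorphD; apply: congrD; apply: ghost_congr.
Qed.

Lemma wmul_poly_ex : exists s : nat -> A, forall k, (k <= n)%N ->
  ghost s k = ghost (X : nat -> A) k * ghost (Y : nat -> A) k.
Proof.
have hF := mpoly_frobP S N; apply: (dwork hF) => k _.
by rewrite rmorphM; apply: congrM; apply: ghost_congr.
Qed.

(* The coefficients are taken in R, which is torsion free, so that the
   polynomials are determined by their ghost components. *)
Definition wadd_poly : nat -> {mpoly R[N]} := projT1 (cid wadd_poly_ex).
Definition wmul_poly : nat -> {mpoly R[N]} := projT1 (cid wmul_poly_ex).

Lemma wadd_polyP k : (k <= n)%N ->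
  ghost (wadd_poly : nat -> A) k
  = ghost (X : nat -> A) k + ghost (Y : nat -> A) k.
Proof. exact: (projT2 (cid wadd_poly_ex)). Qed.

Lemma wmul_polyP k : (k <= n)%N ->
  ghost (wmul_poly : nat -> A) k
  = ghost (X : nat -> A) k * ghost (Y : nat -> A) k.
Proof. exact: (projT2 (cid wmul_poly_ex)). Qed.
End Pair.

Section Single.
Let X (i : nat) : {mpoly R[n.+1]} := 'X_(inord i : 'I_n.+1).
Local Notation A := (mpoly_ralg S n.+1).

Lemma wopp_poly_ex : exists s : nat -> A, forall k, (k <= n)%N ->
  ghost s k = - ghost (X : nat -> A) k.
Proof.
have hF := mpoly_frobP S n.+1; apply: (dwork hF) => k _.
by rewrite rmorphN; apply: congrN; apply: ghost_congr.
Qed.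

Definition wopp_poly : nat -> {mpoly R[n.+1]} := projT1 (cid wopp_poly_ex).

Lemma wopp_polyP k : (k <= n)%N ->
  ghost (wopp_poly : nat -> A) k = - ghost (X : nat -> A) k.
Proof. exact: (projT2 (cid wopp_poly_ex)). Qed.
End Single.

Section Frob.
Let X (i : nat) : {mpoly R[n.+2]} := 'X_(inord i : 'I_n.+2).
Local Notation A := (mpoly_ralg S n.+2).

Lemma wfrob_poly_ex : exists s : nat -> A, forall k, (k <= n)%N ->
  ghost s k = ghost (X : nat -> A) k.+1.
Proof.
have hF := mpoly_frobP S n.+2; apply: (dwork hF) => k _.
apply: (@congr_le _ _ k.+1 k.+2) => //; exact: ghost_congr.
Qed.

Definition wfrob_poly : nat -> {mpoly R[n.+2]} := projT1 (cid wfrob_poly_ex).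

Lemma wfrob_polyP k : (k <= n)%N ->
  ghost (wfrob_poly : nat -> A) k = ghost (X : nat -> A) k.+1.
Proof. exact: (projT2 (cid wfrob_poly_ex)). Qed.
End Frob.

End Universal.

Definition witt (B : ralg S) (n : nat) : Type := {ffun 'I_n.+1 -> B}.

Section Ops.
Variable n : nat.
Implicit Types B C : ralg S.

HB.instance Definition _ B := Choice.on (witt B n).

Definition wcoef B (x : witt B n) (i : nat) : B := x (inord i).
Definition wmk B (f : nat -> B) : witt B n := [ffun i : 'I_n.+1 => f i].
Definition ghostw B (x : witt B n) (k : nat) : B := ghost (wcoef x) k.
Definition wmap B C (f : B -> C) (x : witt B n) : witt C n :=
  [ffun i => f (x i)].

Definition vpair B (x y : witt B n) (i : 'I_(n.+1 + n.+1)) : B :=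
  match split i with inl a => x a | inr b => y b end.

Definition wzero B : witt B n := wmk (fun=> 0).
Definition wone B : witt B n := wmk (fun k => (k == 0%N)%:R).
Definition wadd B (x y : witt B n) : witt B n :=
  wmk (fun k => mev (vpair x y) (wadd_poly n k)).
Definition wmul B (x y : witt B n) : witt B n :=
  wmk (fun k => mev (vpair x y) (wmul_poly n k)).
Definition wopp B (x : witt B n) : witt B n :=
  wmk (fun k => mev x (wopp_poly n k)).

Lemma wcoef_mk B (f : nat -> B) i : (i <= n)%N -> wcoef (wmk f) i = f i.
Proof. by move=> h; rewrite /wcoef ffunE inordK. Qed.

Lemma wcoef_map B C (f : B -> C) x i : wcoef (wmap f x) i = f (wcoef x i).
Proof. by rewrite /wcoef ffunE. Qed.

Lemma witt_eq B (x y : witt B n) :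
  (forall i, (i <= n)%N -> wcoef x i = wcoef y i) -> x = y.
Proof.
move=> h; apply/ffunP => i; have := h i; rewrite /wcoef inord_val; apply.
by rewrite -ltnS.
Qed.

Lemma witt_ghost_eq B (x y : witt B n) : torsion_free B ->
  (forall k, (k <= n)%N -> ghostw x k = ghostw y k) -> x = y.
Proof. by move=> tf h; apply: witt_eq; apply: ghost_inj. Qed.

Lemma ghost_mk B (f : nat -> B) k : (k <= n)%N -> ghostw (wmk f) k = ghost f k.
Proof. by move=> kn; apply: eq_ghost => i ik; rewrite wcoef_mk // (leq_trans ik). Qed.

Lemma vpairl B (x y : witt B n) i : vpair x y (lshift n.+1 i) = x i.
Proof. by rewrite /vpair (unsplitK (inl i)). Qed.

Lemma vpairr B (x y : witt B n) i : vpair x y (rshift n.+1 i) = y i.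
Proof. by rewrite /vpair (unsplitK (inr i)). Qed.

Lemma ghost_mev B N (v : 'I_N -> B) (f : nat -> {mpoly R[N]}) k :
  ghost (fun i => mev v (f i)) k = mev v (ghost (f : nat -> mpoly_ralg S N) k).
Proof.
apply/esym/(@ghost_hom K S (mpoly_ralg S N) B
  (mev v : {rmorphism {mpoly R[N]} -> B})).
exact: mevC. Qed.

Lemma ghostw_add B (x y : witt B n) k : (k <= n)%N ->
  ghostw (wadd x y) k = ghostw x k + ghostw y k.
Proof.
move=> kn; rewrite ghost_mk // ghost_mev (wadd_polyP kn) rmorphD /=.
by congr (_ + _); apply: etrans (esym (ghost_mev _ _ _)) _; apply: eq_ghost => i _; rewrite mevX ?vpairl ?vpairr.
Qed.

Lemma ghostw_mul B (x y : witt B n) k : (k <= n)%N ->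
  ghostw (wmul x y) k = ghostw x k * ghostw y k.
Proof.
move=> kn; rewrite ghost_mk // ghost_mev (wmul_polyP kn) rmorphM /=.
by congr (_ * _); apply: etrans (esym (ghost_mev _ _ _)) _; apply: eq_ghost => i _; rewrite mevX ?vpairl ?vpairr.
Qed.

Lemma ghostw_opp B (x : witt B n) k : (k <= n)%N ->
  ghostw (wopp x) k = - ghostw x k.
Proof.
move=> kn; rewrite ghost_mk // ghost_mev (wopp_polyP kn) rmorphN /=.
by congr (- _); apply: etrans (esym (ghost_mev _ _ _)) _; apply: eq_ghost => i _; rewrite mevX.
Qed.

Lemma ghostw_zero B k : (k <= n)%N -> ghostw (wzero B) k = 0.
Proof.
move=> kn; rewrite ghost_mk // /ghost big1 // => i _.
by rewrite expr0n gtn_eqF ?mulr0 // expn_gt0 q_gt0.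
Qed.

Lemma ghostw_one B k : (k <= n)%N -> ghostw (wone B) k = 1.
Proof.
move=> kn; rewrite ghost_mk // /ghost big_ord_recl /= expr1n mulr1 big1 ?addr0 //.
by move=> i _; rewrite expr0n gtn_eqF ?mulr0 // expn_gt0 q_gt0.
Qed.

Lemma ghostw_map B C (f : rhom B C) (x : witt B n) k :
  ghostw (wmap f x) k = f (ghostw x k).
Proof.
rewrite /ghostw (ghost_hom _ _ (rhom_wpi f)).
by apply: eq_ghost => i _; rewrite wcoef_map.
Qed.

Lemma wmap_add B C (f : rhom B C) (x y : witt B n) :
  wmap f (wadd x y) = wadd (wmap f x) (wmap f y).
Proof.
apply/ffunP => i; rewrite !ffunE rhom_mev; congr mev; apply/funext => j.
by rewrite /vpair; case: split => a; rewrite ffunE.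
Qed.

Lemma wmap_mul B C (f : rhom B C) (x y : witt B n) :
  wmap f (wmul x y) = wmul (wmap f x) (wmap f y).
Proof.
apply/ffunP => i; rewrite !ffunE rhom_mev; congr mev; apply/funext => j.
by rewrite /vpair; case: split => a; rewrite ffunE.
Qed.

Lemma wmap_opp B C (f : rhom B C) (x : witt B n) :
  wmap f (wopp x) = wopp (wmap f x).
Proof.
apply/ffunP => i; rewrite !ffunE rhom_mev; congr mev; apply/funext => j.
by rewrite ffunE.
Qed.

Lemma wmap_zero B C (f : rhom B C) : wmap f (wzero B) = wzero C.
Proof. by apply/ffunP => i; rewrite !ffunE rmorph0. Qed.

Lemma wmap_one B C (f : rhom B C) : wmap f (wone B) = wone C.
Proof. by apply/ffunP => i; rewrite !ffunE rmorph_nat. Qed.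

Lemma witt_lift B (x y z : witt B n) :
  exists (A : ralg S) (f : rhom A B) (x' y' z' : witt A n),
    [/\ torsion_free A, x = wmap f x', y = wmap f y' & z = wmap f z'].
Proof.
pose v (i : 'I_(n.+1 + (n.+1 + n.+1))) :=
  match split i with inl a => x a | inr b => vpair y z b end.
exists (mpoly_ralg S (n.+1 + (n.+1 + n.+1))), (mev_rhom v).
exists [ffun i => 'X_(lshift _ i)], [ffun i => 'X_(rshift _ (lshift _ i))],
  [ffun i => 'X_(rshift _ (rshift _ i))].
split; first exact: mpoly_tf.
all: apply/ffunP => i; rewrite !ffunE /= mevX /v.
- by rewrite (unsplitK (inl i)).
- by rewrite (unsplitK (inr (lshift _ i))) vpairl.
- by rewrite (unsplitK (inr (rshift _ i))) vpairr.
Qed.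

Lemma waddA B : associative (@wadd B).
Proof.
move=> x y z; have [A [f [x' [y' [z' [tf -> -> ->]]]]]] := witt_lift x y z.
rewrite -!wmap_add; congr wmap; apply: witt_ghost_eq tf _.
move=> k kn; have e := @ghostw_add A _ _ k kn.
by rewrite !e addrA.
Qed.

Lemma waddC B : commutative (@wadd B).
Proof.
move=> x y; have [A [f [x' [y' [_ [tf -> -> _]]]]]] := witt_lift x y x.
rewrite -!wmap_add; congr wmap; apply: witt_ghost_eq tf _.
move=> k kn; have e := @ghostw_add A _ _ k kn.
by rewrite !e addrC.
Qed.

Lemma wadd0 B : left_id (wzero B) (@wadd B).
Proof.
move=> x; have [A [f [x' [_ [_ [tf -> _ _]]]]]] := witt_lift x x x.
rewrite -(wmap_zero f) -wmap_add; congr wmap.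
apply: witt_ghost_eq tf _ => k kn.
by rewrite (ghostw_add _ _ kn) (ghostw_zero _ kn) add0r.
Qed.

Lemma waddN B : left_inverse (wzero B) (@wopp B) (@wadd B).
Proof.
move=> x; have [A [f [x' [_ [_ [tf -> _ _]]]]]] := witt_lift x x x.
rewrite -(wmap_zero f) -wmap_opp -wmap_add; congr wmap.
apply: witt_ghost_eq tf _ => k kn.
by rewrite (ghostw_add _ _ kn) (ghostw_opp _ kn) (ghostw_zero _ kn) addNr.
Qed.

Lemma wmulA B : associative (@wmul B).
Proof.
move=> x y z; have [A [f [x' [y' [z' [tf -> -> ->]]]]]] := witt_lift x y z.
rewrite -!wmap_mul; congr wmap; apply: witt_ghost_eq tf _.
move=> k kn; have e := @ghostw_mul A _ _ k kn.
by rewrite !e mulrA.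
Qed.

Lemma wmulC B : commutative (@wmul B).
Proof.
move=> x y; have [A [f [x' [y' [_ [tf -> -> _]]]]]] := witt_lift x y x.
rewrite -!wmap_mul; congr wmap; apply: witt_ghost_eq tf _.
move=> k kn; have e := @ghostw_mul A _ _ k kn.
by rewrite !e mulrC.
Qed.

Lemma wmul1 B : left_id (wone B) (@wmul B).
Proof.
move=> x; have [A [f [x' [_ [_ [tf -> _ _]]]]]] := witt_lift x x x.
rewrite -(wmap_one f) -wmap_mul; congr wmap.
apply: witt_ghost_eq tf _ => k kn.
by rewrite (ghostw_mul _ _ kn) (ghostw_one _ kn) mul1r.
Qed.

Lemma wmulDl B : left_distributive (@wmul B) (@wadd B).
Proof.
move=> x y z; have [A [f [x' [y' [z' [tf -> -> ->]]]]]] := witt_lift x y z.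
rewrite -!wmap_add -!wmap_mul -wmap_add; congr wmap.
apply: witt_ghost_eq tf _ => k kn.
have e := @ghostw_add A _ _ k kn.
have e' := @ghostw_mul A _ _ k kn.
by rewrite e !e' e mulrDl.
Qed.

HB.instance Definition _ B := GRing.isZmodule.Build (witt B n)
  (@waddA B) (@waddC B) (@wadd0 B) (@waddN B).
HB.instance Definition _ B := GRing.Zmodule_isComPzRing.Build (witt B n)
  (@wmulA B) (@wmulC B) (@wmul1 B) (@wmulDl B).

Lemma wmap_zmod B C (f : rhom B C) :
  zmod_morphism (wmap f : witt B n -> witt C n).
Proof. by move=> x y; rewrite [LHS]wmap_add wmap_opp. Qed.
Lemma wmap_monoid B C (f : rhom B C) :
  monoid_morphism (wmap f : witt B n -> witt C n).
Proof. by split=> [|x y]; [exact: wmap_one | exact: wmap_mul]. Qed.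

End Ops.
End Witt.

Arguments wmap_zmod {K S} n {B C} f.
Arguments wmap_monoid {K S} n {B C} f.

Section WittAlgebra.
Variables (K : base_prime) (S : delta_dvr K).
Local Notation R := (dR S).
Local Notation w := (dpi S).
Local Notation q := (res_card K).

Definition base_ralg : ralg S := RAlg (idfun : {rmorphism R -> R}).

Lemma base_frobP :
  @frob_lift K S base_ralg (@dphi K S : {rmorphism R -> R}).
Proof. by split; [exact: dphi_pi | exact: dphi_congr]. Qed.

Lemma exp_delta_ex n (r : R) : exists x : nat -> base_ralg,
  forall k, (k <= n)%N -> ghost x k = iter k (@dphi K S) r.
Proof.
apply: (dwork base_frobP) => k _; exact: congr_refl.
Qed.

Definition exp_delta n (r : R) : witt base_ralg n :=
  wmk n (projT1 (cid (exp_delta_ex n r))).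

Lemma ghostw_exp n r k : (k <= n)%N ->
  ghostw (exp_delta n r) k = iter k (@dphi K S) r.
Proof.
move=> kn; rewrite ghost_mk //; exact: (projT2 (cid (exp_delta_ex n r))).
Qed.

Lemma iter_dphi_zmod k : zmod_morphism (iter k (@dphi K S)).
Proof. by elim: k => // k IH x y; rewrite !iterS IH rmorphB. Qed.

Lemma iter_dphi_monoid k : monoid_morphism (iter k (@dphi K S)).
Proof.
elim: k => // k [h1 hM]; split=> [|x y]; first by rewrite iterS h1 rmorph1.
by rewrite !iterS hM rmorphM.
Qed.

Lemma exp_delta_zmod n : zmod_morphism (exp_delta n).
Proof.
move=> x y; apply: (witt_ghost_eq (@base_tf K S)) => k kn.
by rewrite (ghostw_add _ _ kn) (ghostw_opp _ kn) !ghostw_exp // iter_dphi_zmod.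
Qed.

Lemma exp_delta_monoid n : monoid_morphism (exp_delta n).
Proof.
split=> [|x y]; apply: (witt_ghost_eq (@base_tf K S)) => k kn.
  by rewrite ghostw_exp // (ghostw_one _ kn) (iter_dphi_monoid k).1.
by rewrite (ghostw_mul _ _ kn) !ghostw_exp // (iter_dphi_monoid k).2.
Qed.

Lemma str_rhomP (B : ralg S) r : str B (str base_ralg r) = str B r.
Proof. by []. Qed.
Definition str_rhom (B : ralg S) : rhom base_ralg B :=
  @RHom K S base_ralg B (str B) (str_rhomP B).

Section Structure.
Variables (B : ralg S) (n : nat).

Definition wstr (r : R) : witt B n := wmap (str_rhom B) (exp_delta n r).

Lemma wstr_zmod : zmod_morphism wstr.
Proof.
by move=> x y; rewrite /wstr exp_delta_zmod (wmap_zmod n (str_rhom B)).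
Qed.

Lemma wstr_monoid : monoid_morphism wstr.
Proof.
have [h1 hM] := exp_delta_monoid n; have [g1 gM] := wmap_monoid n (str_rhom B).
by split=> [|x y]; rewrite /wstr ?h1 ?hM ?g1 ?gM.
Qed.

HB.instance Definition _ :=
  GRing.isZmodMorphism.Build R (witt B n) wstr wstr_zmod.
HB.instance Definition _ :=
  GRing.isMonoidMorphism.Build R (witt B n) wstr wstr_monoid.

Definition witt_ralg : ralg S := RAlg (wstr : {rmorphism R -> witt B n}).

End Structure.

Lemma ghostw_wstr (B : ralg S) n r k : (k <= n)%N ->
  ghostw (wstr B n r) k = str B (iter k (@dphi K S) r).
Proof. by move=> kn; rewrite (ghostw_map (str_rhom B)) ghostw_exp. Qed.

Section Functoriality.
Variables (B C : ralg S) (n : nat) (f : rhom B C).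

Definition witt_map (x : witt B n) : witt C n := wmap f x.
HB.instance Definition _ :=
  GRing.isZmodMorphism.Build (witt B n) (witt C n) witt_map (wmap_zmod n f).
HB.instance Definition _ :=
  GRing.isMonoidMorphism.Build (witt B n) (witt C n) witt_map (wmap_monoid n f).

Lemma witt_map_str r : witt_map (wstr B n r) = wstr C n r.
Proof. by apply/ffunP => i; rewrite !ffunE rhom_str. Qed.

Definition witt_rhom : rhom (witt_ralg B n) (witt_ralg C n) :=
  @RHom K S (witt_ralg B n) (witt_ralg C n) witt_map witt_map_str.
End Functoriality.

Section Truncation.
Variables (m n : nat) (mn : (m <= n)%N).

Definition wtrunc (B : ralg S) (x : witt B n) : witt B m := wmk m (wcoef x).

Lemma ghostw_trunc (B : ralg S) (x : witt B n) k :
  (k <= m)%N -> ghostw (wtrunc x) k = ghostw x k.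
Proof. exact: ghost_mk. Qed.

Lemma wtrunc_map (B C : ralg S) (f : rhom B C) (x : witt B n) :
  wtrunc (wmap f x) = wmap f (wtrunc x).
Proof. by apply/ffunP => i; rewrite !ffunE wcoef_map. Qed.

Lemma wtrunc_zmod (B : ralg S) : zmod_morphism (@wtrunc B).
Proof.
move=> x y; have [A [f [x' [y' [_ [tf -> -> _]]]]]] := witt_lift x y x.
rewrite -(wmap_zmod n f) !wtrunc_map -(wmap_zmod m f); congr wmap.
apply: (witt_ghost_eq tf) => k km; have kn := leq_trans km mn.
rewrite (ghostw_add _ _ km) (ghostw_opp _ km) !ghostw_trunc //.
by rewrite (ghostw_add _ _ kn) (ghostw_opp _ kn).
Qed.

Lemma wtrunc_monoid (B : ralg S) : monoid_morphism (@wtrunc B).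
Proof.
split=> [|x y].
  apply: witt_eq => i im; rewrite wcoef_mk // !wcoef_mk //.
  exact: leq_trans mn.
have [A [f [x' [y' [_ [tf -> -> _]]]]]] := witt_lift x y x.
rewrite -(wmap_monoid n f).2 !wtrunc_map -(wmap_monoid m f).2; congr wmap.
apply: (witt_ghost_eq tf) => k km; have kn := leq_trans km mn.
by rewrite (ghostw_mul _ _ km) !ghostw_trunc // (ghostw_mul _ _ kn).
Qed.

Definition wtrunc_rmorphism (B : ralg S) : {rmorphism witt B n -> witt B m} :=
  HB.pack (@wtrunc B)
    (GRing.isZmodMorphism.Build (witt B n) (witt B m) (@wtrunc B) (@wtrunc_zmod B))
    (GRing.isMonoidMorphism.Build (witt B n) (witt B m) (@wtrunc B)
       (@wtrunc_monoid B)).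

Lemma wtrunc_str (B : ralg S) r : wtrunc (wstr B n r) = wstr B m r.
Proof.
rewrite (wtrunc_map (str_rhom B)); congr wmap.
apply: (witt_ghost_eq (@base_tf K S)) => k km; have kn := leq_trans km mn.
by rewrite ghostw_trunc // !ghostw_exp.
Qed.

Definition trunc_rhom (B : ralg S) : rhom (witt_ralg B n) (witt_ralg B m) :=
  @RHom K S (witt_ralg B n) (witt_ralg B m) (wtrunc_rmorphism B) (wtrunc_str B).

End Truncation.

Definition twist_ralg (B : ralg S) : ralg S :=
  RAlg (str B \o @dphi K S : {rmorphism R -> B}).

Section TwistMap.
Variables (B C : ralg S) (f : rhom B C).
Lemma twist_rhomP r : f (str (twist_ralg B) r) = str (twist_ralg C) r.
Proof. exact: rhom_str. Qed.
Definition twist_rhom : rhom (twist_ralg B) (twist_ralg C) :=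
  @RHom K S (twist_ralg B) (twist_ralg C) f twist_rhomP.
End TwistMap.

Lemma twist_wpi (B : ralg S) : wpi (twist_ralg B) = wpi B.
Proof. by rewrite /wpi /= dphi_pi. Qed.

Lemma twist_ghost (B : ralg S) (x : nat -> B) k :
  ghost (x : nat -> twist_ralg B) k = ghost x k.
Proof. by apply: eq_bigr => i _; rewrite twist_wpi. Qed.

Lemma twist_tf (B : ralg S) : torsion_free B -> torsion_free (twist_ralg B).
Proof. by move=> tf x; rewrite twist_wpi; apply: tf. Qed.

Section Frobenius.
Variable n : nat.

Definition wfrob (B : ralg S) (x : witt B n.+1) : witt (twist_ralg B) n :=
  wmk n (fun k => mev x (wfrob_poly S n k) : twist_ralg B).

Lemma ghostw_frob (B : ralg S) (x : witt B n.+1) k : (k <= n)%N ->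
  ghostw (wfrob x) k = ghostw x k.+1.
Proof.
move=> kn; rewrite ghost_mk // twist_ghost ghost_mev (wfrob_polyP S kn).
have e := ghost_mev (x : 'I_n.+2 -> B) (fun i : nat => 'X_(inord i)) k.+1.
apply: (etrans (esym e)).
by apply: eq_ghost => i _; rewrite mevX.
Qed.

Lemma wfrob_map (B C : ralg S) (f : rhom B C) (x : witt B n.+1) :
  wfrob (wmap f x) = wmap (twist_rhom f) (wfrob x).
Proof.
apply/ffunP => i; rewrite !ffunE; apply: esym.
apply: (etrans (rhom_mev f (x : 'I_n.+2 -> B) (wfrob_poly S n i))).
by congr mev; apply/funext => j; rewrite ffunE.
Qed.

Lemma wfrob_zmod (B : ralg S) : zmod_morphism (@wfrob B).
Proof.
move=> x y; have [A [f [x' [y' [_ [tf -> -> _]]]]]] := witt_lift x y x.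
rewrite -(wmap_zmod n.+1 f) !wfrob_map -(wmap_zmod n (twist_rhom f)).
congr wmap; apply: (witt_ghost_eq (twist_tf tf)) => k kn.
rewrite (ghostw_add _ _ kn) (ghostw_opp _ kn) !ghostw_frob //.
by rewrite ghostw_add ?ghostw_opp.
Qed.

Lemma wfrob_monoid (B : ralg S) : monoid_morphism (@wfrob B).
Proof.
split=> [|x y].
  have -> : 1 = wmap (str_rhom B) 1 :> witt B n.+1.
    by rewrite (wmap_monoid n.+1 (str_rhom B)).1.
  rewrite wfrob_map -(wmap_monoid n (twist_rhom (str_rhom B))).1.
  congr wmap; apply: (witt_ghost_eq (twist_tf (@base_tf K S))) => k kn.
  by rewrite (ghostw_one _ kn) ghostw_frob // ghostw_one.
have [A [f [x' [y' [_ [tf -> -> _]]]]]] := witt_lift x y x.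
rewrite -(wmap_monoid n.+1 f).2 !wfrob_map -(wmap_monoid n (twist_rhom f)).2.
congr wmap; apply: (witt_ghost_eq (twist_tf tf)) => k kn.
by rewrite (ghostw_mul _ _ kn) !ghostw_frob // ghostw_mul.
Qed.

HB.instance Definition _ B := GRing.isZmodMorphism.Build
  (witt B n.+1) (witt (twist_ralg B) n) (@wfrob B) (@wfrob_zmod B).
HB.instance Definition _ B := GRing.isMonoidMorphism.Build
  (witt B n.+1) (witt (twist_ralg B) n) (@wfrob B) (@wfrob_monoid B).

Lemma wfrob_str (B : ralg S) r :
  wfrob (wstr B n.+1 r) = wstr (twist_ralg B) n r.
Proof.
rewrite (wfrob_map (str_rhom B)).
have -> : wstr (twist_ralg B) n r =
    wmap (twist_rhom (str_rhom B)) (wstr (twist_ralg base_ralg) n r).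
  by apply/ffunP => i; rewrite !ffunE.
congr wmap; apply: (witt_ghost_eq (twist_tf (@base_tf K S))) => k kn.
by rewrite ghostw_frob // ghostw_exp // ghostw_wstr //= -iterS iterSr iterSr.
Qed.

Definition frob_rhom (B : ralg S) :
    rhom (witt_ralg B n.+1) (witt_ralg (twist_ralg B) n) :=
  @RHom K S (witt_ralg B n.+1) (witt_ralg (twist_ralg B) n) (@wfrob B)
    (wfrob_str B).

End Frobenius.

Section Completeness.
Variables (B : ralg S) (n : nat).
Implicit Types x y z : witt B n.

Definition wcongr k x y : Prop := forall i, congr_mod (wpi B ^+ k) (x i) (y i).

Lemma wcongr_add k x y x' y' :
  wcongr k x x' -> wcongr k y y' -> wcongr k (x + y) (x' + y').
Proof.
move=> hx hy i; rewrite !ffunE; apply: mev_congr => j.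
by rewrite /vpair; case: split.
Qed.

Lemma wcongr_opp k x x' : wcongr k x x' -> wcongr k (- x) (- x').
Proof. by move=> hx i; rewrite !ffunE; apply: mev_congr. Qed.

Lemma wcongr_mul k x y x' y' :
  wcongr k x x' -> wcongr k y y' -> wcongr k (x * y) (x' * y').
Proof.
move=> hx hy i; rewrite !ffunE; apply: mev_congr => j.
by rewrite /vpair; case: split.
Qed.

Lemma wcongr_refl k x : wcongr k x x.
Proof. by move=> i; apply: congr_refl. Qed.

Lemma iter_dphi_piX j k : iter j (@dphi K S) (w ^+ k) = w ^+ k.
Proof. by elim: j => //= j ->; rewrite rmorphXn /= dphi_pi. Qed.

Lemma exp_delta_piX k i : (i <= n)%N ->
  congr_mod (w ^+ k) (wcoef (exp_delta n (w ^+ (k + n))) i) 0.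
Proof.
move=> ile; apply: (@congr_le _ _ k (k + n - i)); first by lia.
elim/ltn_ind: i ile => i IH ile.
have := ghostw_exp (w ^+ (k + n)) ile; rewrite iter_dphi_piX /ghostw ghostr.
rewrite /wpi /=; set s := \sum_(j < i) _; set c := wcoef _ i => e.
have [z ez] : congr_mod (w ^+ (k + n)) s 0.
  apply: congr_sum0 => j _; have ji := ltn_ord j.
  have jn := leq_trans (ltnW ji) ile.
  have [u] := IH j ji jn; rewrite subr0 => ->.
  have : (0 < q ^ (i - j))%N by rewrite expn_gt0 q_gt0.
  case: (q ^ (i - j))%N => // t _; rewrite exprS !mulrA -exprD.
  have -> : (j + (k + n - j))%N = (k + n)%N by lia.
  by rewrite -!mulrA; apply: congr_mul0.
rewrite subr0 in ez; exists (1 - z); rewrite subr0.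
apply: (@torsion_freeX K S base_ralg i _ _ (@base_tf K S)).
rewrite /wpi /= mulrA -exprD; have -> : (i + (k + n - i))%N = (k + n)%N by lia.
by rewrite mulrBr mulr1 -ez -e addrC addKr.
Qed.

Lemma wstr_piX k x : wcongr k (wstr B n (w ^+ (k + n)) * x) 0.
Proof.
rewrite -[0](mul0r x); apply: wcongr_mul (wcongr_refl _ _) => i.
have il : (i <= n)%N by rewrite -ltnS.
have [z] := exp_delta_piX k il.
rewrite /wcoef inord_val subr0 /wstr !ffunE => ->.
by rewrite rmorphM rmorphXn /=; apply: congr_mul0.
Qed.

Lemma wpiXE (k : nat) : wpi (witt_ralg B n) ^+ k = wstr B n (w ^+ k).
Proof. by rewrite /wpi rmorphXn. Qed.

Lemma wcongr_of_congr k x y :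
  congr_mod (wpi (witt_ralg B n) ^+ (k + n)) x y -> wcongr k x y.
Proof.
case=> z; rewrite wpiXE => e.
have h : wcongr k (x - y) 0 by rewrite e; apply: wstr_piX.
have := wcongr_add h (wcongr_refl k y).
by rewrite subrK add0r.
Qed.

(* A vector with coordinates divisible by pi^(k + n) is divisible by pi^k; it
   suffices to check this on the generic vector. *)
Lemma generic_div k : exists y : witt (mpoly_ralg S n.+1) n,
  [ffun i => wpi (mpoly_ralg S n.+1) ^+ (k + n) * 'X_i : mpoly_ralg S n.+1]
  = wstr (mpoly_ralg S n.+1) n (w ^+ k) * y :> witt (mpoly_ralg S n.+1) n.
Proof.
set A := mpoly_ralg S n.+1.
have hF := mpoly_frobP S n.+1; have tf := @mpoly_tf K S n.+1.
pose x : witt A n := [ffun i => wpi A ^+ (k + n) * 'X_i : A].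
have xE i : wcoef x i = wpi A ^+ (k + n) * 'X_(inord i : 'I_n.+1).
  by rewrite /wcoef ffunE.
have div j : exists g : A, ghostw x j = wpi A ^+ (k + n) * g.
  suff : congr_mod (wpi A ^+ (k + n)) (ghostw x j) 0.
    by case=> g; rewrite subr0 => ->; exists g.
  apply: congr_sum0 => i _; rewrite xE.
  have : (0 < q ^ (j - i))%N by rewrite expn_gt0 q_gt0.
  case: (q ^ (j - i))%N => // t _; rewrite exprS mulrCA -!mulrA.
  exact: congr_mul0.
pose g j := projT1 (cid (div j)).
have gE j : ghostw x j = wpi A ^+ (k + n) * g j by exact: projT2 (cid (div j)).
have [y hy] : exists y : nat -> A, forall j, (j <= n)%N ->
    ghost y j = wpi A ^+ n * g j.
  apply: (dwork hF) => j jn.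
  apply: (@congr_le _ _ _ n) => //.
  apply: (@congr_trans _ _ 0); first exact: congr_mul0.
  apply: congr_sym; rewrite rmorphM rmorphXn hF.1; exact: congr_mul0.
exists (wmk n y); apply: (witt_ghost_eq tf) => j jn.
rewrite (ghostw_mul _ _ jn) (ghostw_wstr _ _ jn) ghost_mk // hy // gE.
by rewrite iter_dphi_piX rmorphXn -/(wpi A) mulrA exprD.
Qed.

Lemma congr_of_wcongr k x :
  wcongr (k + n) x 0 -> congr_mod (wpi (witt_ralg B n) ^+ k) x 0.
Proof.
move=> h; have hz i : exists z : B, x i = wpi B ^+ (k + n) * z.
  by have [z] := h i; rewrite ffunE subr0 => ->; exists z.
pose v i := projT1 (cid (hz i)).
have vE i : x i = wpi B ^+ (k + n) * v i by exact: projT2 (cid (hz i)).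
have [y hy] := generic_div k; pose f := mev_rhom v.
exists (wmap f y); rewrite subr0 wpiXE -(witt_map_str n f) /witt_map.
apply: etrans _ ((wmap_monoid n f).2 _ _); rewrite -hy.
apply/ffunP => i; rewrite !ffunE vE rmorphM rmorphXn (rhom_wpi f) /=.
by rewrite mevX.
Qed.

Lemma witt_complete : adically_complete (wpi B) ->
  adically_complete (wpi (witt_ralg B n)).
Proof.
case=> sep lim; split=> [x hx|u hu].
  apply/ffunP => i; rewrite ffunE; apply: sep => k.
  have := wcongr_of_congr (hx (k + n)%N) i; by rewrite ffunE.
have hu' k i : congr_mod (wpi B ^+ k) ((u (k + n).+1 : witt B n) i)
    ((u (k + n)%N : witt B n) i).
  exact: (wcongr_of_congr (hu (k + n)%N)).
pose l i := projT1 (cid (lim (fun k => (u (k + n)%N : witt B n) i)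
  (fun k => hu' k i))).
have lE i : forall k, congr_mod (wpi B ^+ k) (l i) ((u (k + n)%N : witt B n) i).
  exact: projT2 (cid (lim _ (fun k => hu' k i))).
pose L : witt B n := [ffun i => l i].
exists L => k.
have step j : congr_mod (wpi (witt_ralg B n) ^+ k) (u (k + j)%N) (u k).
  elim: j => [|j IH]; first by rewrite addn0; apply: congr_refl.
  apply: congr_trans IH; rewrite addnS.
  by apply: congr_le (hu (k + j)%N); rewrite leq_addr.
apply: congr_trans (step (n + n)%N).
set U : witt B n := u (k + (n + n))%N.
have h : wcongr (k + n) L U.
  by move=> i; rewrite ffunE /U addnA; apply: lE.
have {}h : wcongr (k + n) (L - U) 0.
  have := wcongr_add h (wcongr_opp (wcongr_refl (k + n) U)); by rewrite subrr.
have [z] := congr_of_wcongr h; rewrite subr0 => e.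
by exists z.
Qed.

End Completeness.
End WittAlgebra.

Section FormalSchemes.
Variables (K : base_prime) (S : delta_dvr K).
Local Notation R := (dR S).
Local Notation w := (dpi S).
Local Notation q := (res_card K).

(* A formal scheme is represented by its points in pi-adically complete
   R-algebras; R-algebra homomorphisms between these are automatically
   continuous. *)
Record calg := CAlg {
  calg_ralg :> ralg S;
  calg_complete : adically_complete (wpi calg_ralg)
}.

Definition base_calg : calg := @CAlg (base_ralg S) (dR_complete S).

Definition witt_calg (n : nat) (B : calg) : calg :=
  @CAlg (witt_ralg B n) (witt_complete n (@calg_complete B)).

Lemma twist_complete (B : calg) : adically_complete (wpi (twist_ralg B)).
Proof. rewrite twist_wpi; exact: calg_complete. Qed.

Definition twist (B : calg) : calg := CAlg (twist_complete B).

Definition rid (B : ralg S) : rhom B B :=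
  @RHom K S B B (idfun : {rmorphism B -> B}) (fun=> erefl).

Lemma rcomp_str (B C D : ralg S) (g : rhom C D) (f : rhom B C) r :
  (g \o f) (str B r) = str D r.
Proof. by rewrite /= !rhom_str. Qed.

Definition rcomp (B C D : ralg S) (g : rhom C D) (f : rhom B C) : rhom B D :=
  @RHom K S B D (g \o f : {rmorphism B -> D}) (rcomp_str g f).

Record presheaf := Presheaf {
  pts :> calg -> Type;
  act : forall B C : calg, rhom B C -> pts B -> pts C;
  act_id : forall (B : calg) (x : pts B), act (rid B) x = x;
  act_comp : forall (B C D : calg) (g : rhom C D) (f : rhom B C) (x : pts B),
    act (rcomp g f) x = act g (act f x)
}.

Record morphism (X Y : presheaf) := Morphism {
  mor :> forall B : calg, X B -> Y B;
  mor_act : forall (B C : calg) (f : rhom B C) (x : X B),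
    mor (act f x) = act f (mor x)
}.

Definition is_iso (X Y : presheaf) (t : morphism X Y) : Prop :=
  forall B : calg, bijective (t B).

Section Spf.
Variable A : calg.
Lemma Spf_id (B : calg) (x : rhom A B) : rcomp (rid B) x = x.
Proof. exact: rhom_ext. Qed.
Lemma Spf_comp (B C D : calg) (g : rhom C D) (f : rhom B C) (x : rhom A B) :
  rcomp (rcomp g f) x = rcomp g (rcomp f x).
Proof. exact: rhom_ext. Qed.
Definition Spf : presheaf :=
  @Presheaf (fun B => rhom A B) (fun B C f x => rcomp f x) Spf_id Spf_comp.
End Spf.

(* The pi-adic completion of the localization of B at f, through its
   universal property. *)
Definition is_completed_localization (B L : calg) (f : B) (l : rhom B L) :
    Prop :=
  (exists y : L, l f * y = 1) /\
  forall (C : calg) (g : rhom B C), (exists y : C, g f * y = 1) ->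
    exists h : rhom L C, (forall b, h (l b) = g b) /\
      forall h' : rhom L C, (forall b, h' (l b) = g b) -> h' = h.

Definition zariski_sheaf (X : presheaf) : Prop :=
  forall (B : calg) (r : nat) (f : 'I_r -> B),
    ideal_gen [set f i | i in setT] 1 ->
  forall (L : 'I_r -> calg) (l : forall i, rhom B (L i)),
    (forall i, is_completed_localization (f i) (l i)) ->
  forall (L2 : 'I_r -> 'I_r -> calg) (l2 : forall i j, rhom B (L2 i j)),
    (forall i j, is_completed_localization (f i * f j) (l2 i j)) ->
  forall (a1 : forall i j, rhom (L i) (L2 i j))
         (a2 : forall i j, rhom (L j) (L2 i j)),
    (forall i j b, a1 i j (l i b) = l2 i j b) ->
    (forall i j b, a2 i j (l j b) = l2 i j b) ->
  forall x : forall i, X (L i),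
    (forall i j, act (a1 i j) (x i) = act (a2 i j) (x j)) ->
  exists y : X B, (forall i, act (l i) y = x i) /\
    forall y' : X B, (forall i, act (l i) y' = x i) -> y' = y.

(* The j_i are open immersions covering X: for every x : Spf B -> X, the
   inverse image of the i-th piece is the open subset of Spf B where D_i
   generates the unit ideal, and these open subsets cover Spf B.  No
   condition modulo pi is needed: pi is in the Jacobson radical of a
   pi-adically complete algebra. *)
Definition affine_open_cover (X : presheaf) (I : Type) (A : I -> calg)
    (j : forall i, morphism (Spf (A i)) X) : Prop :=
  (forall i (B : calg), injective (j i B)) /\
  forall (B : calg) (x : X B), exists D : I -> set B,
    (forall i (C : calg) (g : rhom B C),
       (exists a, j i C a = act g x) <-> ideal_gen [set g e | e in D i] 1) /\
    ideal_gen [set e | exists i, D i e] 1.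

Definition formal_scheme (X : presheaf) : Prop :=
  zariski_sheaf X /\
  exists (I : Type) (A : I -> calg) (j : forall i, morphism (Spf (A i)) X),
    affine_open_cover j.

Section FibreProduct.
Variables (X Y Z : presheaf) (f : morphism X Z) (g : morphism Y Z).
Definition fib_pts (B : calg) : Type := {z : X B * Y B | f B z.1 = g B z.2}.

Lemma fib_act_subproof (B C : calg) (h : rhom B C) (z : fib_pts B) :
  f C (act h (sval z).1) = g C (act h (sval z).2).
Proof. by case: z => -[x y] /= e; rewrite !mor_act e. Qed.

Definition fib_act (B C : calg) (h : rhom B C) (z : fib_pts B) : fib_pts C :=
  exist (fun z : X C * Y C => f C z.1 = g C z.2)
    (act h (sval z).1, act h (sval z).2) (fib_act_subproof h z).

Lemma fib_id (B : calg) (z : fib_pts B) : fib_act (rid B) z = z.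
Proof. by case: z => -[x y] e; apply: eq_exist; rewrite /= !act_id. Qed.

Lemma fib_comp (B C D : calg) (h' : rhom C D) (h : rhom B C) (z : fib_pts B) :
  fib_act (rcomp h' h) z = fib_act h' (fib_act h z).
Proof. by case: z => -[x y] e; apply: eq_exist; rewrite /= !act_comp. Qed.

Definition fibprod : presheaf := Presheaf fib_id fib_comp.
End FibreProduct.

(* The points of X in B when B is viewed as an R-algebra through phi; a
   morphism Y -> frob_twist X is a morphism from Y to X over Spf phi. *)
Section FrobTwist.
Variable X : presheaf.
Definition ftwist_act (B C : calg) (f : rhom B C) :
  X (twist B) -> X (twist C) := @act X (twist B) (twist C) (twist_rhom f).
Lemma ftwist_id (B : calg) (x : X (twist B)) : ftwist_act (rid B) x = x.
Proof. by rewrite -[RHS]act_id; congr act; apply: rhom_ext. Qed.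
Lemma ftwist_comp (B C D : calg) (g : rhom C D) (f : rhom B C)
  (x : X (twist B)) :
  ftwist_act (rcomp g f) x = ftwist_act g (ftwist_act f x).
Proof. by rewrite /ftwist_act -act_comp; congr act; apply: rhom_ext. Qed.
Definition frob_twist : presheaf := Presheaf ftwist_id ftwist_comp.
End FrobTwist.

(* W_n(B) is the R-algebra witt_ralg B n, with structure map induced by
   exp_delta. *)
Section Jet.
Variables (n : nat) (X : presheaf).
Definition jet_act (B C : calg) (f : rhom B C) :
  X (witt_calg n B) -> X (witt_calg n C) :=
  @act X (witt_calg n B) (witt_calg n C) (witt_rhom n f).
Lemma jet_id (B : calg) (x : X (witt_calg n B)) : jet_act (rid B) x = x.
Proof.
rewrite -[RHS]act_id; congr act; apply: rhom_ext => y.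
by apply/ffunP => i; rewrite ffunE.
Qed.
Lemma jet_comp (B C D : calg) (g : rhom C D) (f : rhom B C)
  (x : X (witt_calg n B)) : jet_act (rcomp g f) x = jet_act g (jet_act f x).
Proof.
rewrite /jet_act -act_comp; congr act; apply: rhom_ext => y.
by apply/ffunP => i; rewrite !ffunE.
Qed.
Definition jet : presheaf := Presheaf jet_id jet_comp.
End Jet.

Section JetProjection.
Variables (m n : nat) (mn : (m <= n)%N) (X : presheaf).
Definition jet_proj_fun (B : calg) : jet n X B -> jet m X B :=
  @act X (witt_calg n B) (witt_calg m B) (trunc_rhom mn B).
Lemma jet_proj_act (B C : calg) (f : rhom B C) (x : jet n X B) :
  jet_proj_fun (act f x) = act f (jet_proj_fun x).
Proof.
rewrite /jet_proj_fun /= /jet_act -!act_comp; congr act.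
by apply: rhom_ext => y; apply: wtrunc_map.
Qed.
Definition jet_proj : morphism (jet n X) (jet m X) := Morphism jet_proj_act.
End JetProjection.

Section JetFrobenius.
Variables (n : nat) (X : presheaf).
Definition jet_frob_fun (B : calg) :
    jet n.+1 X B -> frob_twist (jet n X) B :=
  @act X (witt_calg n.+1 B) (witt_calg n (twist B)) (frob_rhom n B).
Lemma jet_frob_act (B C : calg) (f : rhom B C) (x : jet n.+1 X B) :
  jet_frob_fun (act f x) = act f (jet_frob_fun x).
Proof.
rewrite /jet_frob_fun /= /ftwist_act /= /jet_act -!act_comp; congr act.
by apply: rhom_ext => y; apply: wfrob_map.
Qed.
Definition jet_frob : morphism (jet n.+1 X) (frob_twist (jet n X)) :=
  Morphism jet_frob_act.
End JetFrobenius.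

Section WittZero.
Variable B : ralg S.
Definition witt0 (b : B) : witt B 0 := wmk 0 (fun=> b).

Lemma ghostw0 (x : witt B 0) : ghostw x 0 = wcoef x 0.
Proof. by rewrite /ghostw /ghost big_ord_recl big_ord0 addr0 mul1r expr1. Qed.

Lemma witt0_eq (x : witt B 0) : x = witt0 (ghostw x 0).
Proof.
apply: witt_eq => i; rewrite leqn0 => /eqP ->.
by rewrite wcoef_mk // ghostw0.
Qed.

Lemma ghostw_witt0 b : ghostw (witt0 b) 0 = b.
Proof. by rewrite ghostw0 wcoef_mk. Qed.

Lemma witt0_zmod : zmod_morphism witt0.
Proof.
move=> x y; apply: esym; rewrite [LHS]witt0_eq; congr witt0.
by rewrite ghostw_add // ghostw_opp // !ghostw_witt0.
Qed.

Lemma witt0_monoid : monoid_morphism witt0.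
Proof.
split=> [|x y]; apply: esym; rewrite [LHS]witt0_eq; congr witt0.
  by rewrite ghostw_one.
by rewrite ghostw_mul // !ghostw_witt0.
Qed.

HB.instance Definition _ :=
  GRing.isZmodMorphism.Build B (witt B 0) witt0 witt0_zmod.
HB.instance Definition _ :=
  GRing.isMonoidMorphism.Build B (witt B 0) witt0 witt0_monoid.

Lemma witt0_str r : witt0 (str B r) = str (witt_ralg B 0) r.
Proof. by rewrite [RHS]witt0_eq ghostw_wstr. Qed.

Definition witt0_rhom : rhom B (witt_ralg B 0) :=
  @RHom K S B (witt_ralg B 0) witt0 witt0_str.
End WittZero.

Section JetZero.
Variable X : presheaf.
Definition jet0_fun (B : calg) : X B -> jet 0 X B :=
  @act X B (witt_calg 0 B) (witt0_rhom B).
Lemma jet0_act (B C : calg) (f : rhom B C) (x : X B) :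
  jet0_fun (act f x) = act f (jet0_fun x).
Proof.
rewrite /jet0_fun /= /jet_act -!act_comp; congr act; apply: rhom_ext => y.
by apply/ffunP => i; rewrite !ffunE.
Qed.
Definition jet0_unit : morphism X (jet 0 X) := Morphism jet0_act.
End JetZero.

Section PowerFrobenius.
Variables (B : calg) (B0 : wpi B = 0).

Definition power_frob (b : B) : twist B := b ^+ q.

Lemma power_frobD (x y : B) : (x + y) ^+ q = x ^+ q + y ^+ q.
Proof.
have h := wpi_congr_p B; rewrite B0 in h.
have [z] := congr_frob_add (res_deg K) x y (res_char_prime K) h.
by rewrite mul0r => /eqP; rewrite subr_eq0 => /eqP.
Qed.

Lemma power_frob_zmod : zmod_morphism power_frob.
Proof.
move=> x y; apply: (addIr (power_frob y)); rewrite subrK /power_frob.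
by rewrite -power_frobD subrK.
Qed.

Lemma power_frob_monoid : monoid_morphism power_frob.
Proof. by split=> [|x y]; rewrite /power_frob ?expr1n ?exprMn. Qed.

Lemma power_frob_str r : power_frob (str B r) = str (twist B) r.
Proof.
have [z /(congr1 (str B))] := dphi_congr (r : R).
rewrite rmorphB rmorphM -/(wpi B) B0 mul0r rmorphXn => /eqP.
by rewrite subr_eq0 => /eqP e; exact: esym e.
Qed.

Definition power_frob_rhom : rhom B (twist B) :=
  @RHom K S B (twist B)
    (HB.pack power_frob
       (GRing.isZmodMorphism.Build B (twist B) power_frob power_frob_zmod)
       (GRing.isMonoidMorphism.Build B (twist B) power_frob power_frob_monoid)
     : {rmorphism B -> twist B})
    power_frob_str.
End PowerFrobenius.

Record prolongation_data := ProlongationData {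
  level :> nat -> presheaf;
  lproj : forall n, morphism (level n.+1) (level n);
  lfrob : forall n, morphism (level n.+1) (frob_twist (level n))
}.

(* By the third condition lfrob n agrees modulo pi, i.e. on points in algebras
   killed by pi, with lproj n followed by the q-th power Frobenius. *)
Definition is_prolongation_sequence (T : prolongation_data) : Prop :=
  [/\ forall n, formal_scheme (T n),
      forall n (B : calg) (x : T n.+2 B),
        lfrob T n B (lproj T n.+1 B x)
        = lproj T n (twist B) (lfrob T n.+1 B x) &
      forall n (B : calg) (B0 : wpi B = 0) (x : T n.+1 B),
        lfrob T n B x
        = @act (T n) B (twist B) (power_frob_rhom B0) (lproj T n B x)].

Definition jet_sequence (Y : presheaf) : prolongation_data :=
  @ProlongationData (fun n => jet n Y)
    (fun n => jet_proj (leqnSn n) Y) (fun n => jet_frob n Y).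

(* T is the canonical prolongation sequence of T 0, where T 0 is identified
   with J^0 (T 0) through the isomorphism of B with W_0(B). *)
Definition is_canonical_prolongation_sequence (T : prolongation_data) : Prop :=
  is_prolongation_sequence T /\
  exists t : forall n, morphism (T n) (jet_sequence (T 0%N) n),
    [/\ forall n, is_iso (t n),
        forall (B : calg) (x : T 0%N B), t 0%N B x = jet0_unit (T 0%N) B x,
        forall n (B : calg) (x : T n.+1 B),
          t n B (lproj T n B x)
          = lproj (jet_sequence (T 0%N)) n B (t n.+1 B x) &
        forall n (B : calg) (x : T n.+1 B),
          t n (twist B) (lfrob T n B x)
          = lfrob (jet_sequence (T 0%N)) n B (t n.+1 B x)].

Lemma exp_rhomP n r :
  @exp_delta K S n (str base_calg r) = str (witt_calg n base_calg) r.
Proof. by apply/ffunP => i; rewrite !ffunE. Qed.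

Section ExpHom.
Variable n : nat.
HB.instance Definition _ :=
  GRing.isZmodMorphism.Build R (witt (base_ralg S) n) (@exp_delta K S n)
    (@exp_delta_zmod K S n).
HB.instance Definition _ :=
  GRing.isMonoidMorphism.Build R (witt (base_ralg S) n) (@exp_delta K S n)
    (@exp_delta_monoid K S n).
End ExpHom.

Definition exp_rhom n : rhom base_calg (witt_calg n base_calg) :=
  @RHom K S base_calg (witt_calg n base_calg)
    (@exp_delta K S n : {rmorphism R -> witt (base_ralg S) n}) (exp_rhomP n).

Section Kernel.
Variables (X : presheaf) (P0 : morphism (Spf base_calg) X) (m : nat).

Definition marked_jet_fun (B : calg) (s : Spf base_calg B) : jet m X B :=
  P0 (witt_calg m B) (rcomp (witt_rhom m s) (exp_rhom m)).
Lemma marked_jet_act (B C : calg) (f : rhom B C) (s : Spf base_calg B) :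
  marked_jet_fun (act f s) = act f (marked_jet_fun s).
Proof.
rewrite /marked_jet_fun /= /jet_act -mor_act; congr (mor _ _).
by apply: rhom_ext => r; apply/ffunP => i; rewrite !ffunE.
Qed.
Definition marked_jet : morphism (Spf base_calg) (jet m X) :=
  Morphism marked_jet_act.

Definition Nspace (n : nat) : presheaf :=
  fibprod (jet_proj (leq_addr n m) X) marked_jet.

Section NspaceProjection.
Variable n : nat.
Definition Nproj_jet : morphism (jet (m + n.+1) X) (jet (m + n) X) :=
  jet_proj (leq_add (leqnn m) (leqnSn n)) X.

Lemma Nproj_subproof (B : calg) (z : Nspace n.+1 B) :
  jet_proj (leq_addr n m) X B (Nproj_jet B (sval z).1)
  = marked_jet B (sval z).2.
Proof.
case: z => -[x s] /= <-; rewrite /jet_proj_fun -act_comp; congr act.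
apply: rhom_ext => y; apply/ffunP => i; rewrite !ffunE wcoef_mk //.
by rewrite (leq_trans _ (leq_addr n m)) // -ltnS.
Qed.

Definition Nproj_fun (B : calg) (z : Nspace n.+1 B) : Nspace n B :=
  exist (fun z : jet (m + n) X B * Spf base_calg B =>
           jet_proj (leq_addr n m) X B z.1 = marked_jet B z.2)
    (Nproj_jet B (sval z).1, (sval z).2) (Nproj_subproof z).

Lemma Nproj_act (B C : calg) (f : rhom B C) (z : Nspace n.+1 B) :
  Nproj_fun (act f z) = act f (Nproj_fun z).
Proof. by case: z => -[x s] e; apply: eq_exist; rewrite /= jet_proj_act. Qed.

Definition Nspace_proj : morphism (Nspace n.+1) (Nspace n) :=
  Morphism Nproj_act.
End NspaceProjection.

(* The sequence of the N^{[m]n} X for n >= 1, re-indexed from 0. *)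
Definition Nspace_sequence
    (f : forall n, morphism (Nspace n.+2) (frob_twist (Nspace n.+1))) :
    prolongation_data :=
  @ProlongationData (fun n => Nspace n.+1) (fun n => Nspace_proj n.+1) f.

End Kernel.
End FormalSchemes.

(* Main.v *)
Require Import Defs.
From HB Require Import structures.
From mathcomp Require Import all_boot all_algebra.
From mathcomp Require Import boolp classical_sets.
From mathcomp Require Import mpoly zify ring.

(* Let Spf A be an open affine piece of X through which P_0 : Spf R -> X
   factors; it exists because R is local.  The kernel V^(m+1) W_(n-1)(B) of
   the truncation W_(m+n)(B) -> W_m(B) lies in the Jacobson radical, so every
   point of N^{[m]n} X comes from Spf A, i.e. it is a homomorphism
   A -> W_(m+n)(B) that lifts exp_delta o P_0 modulo this kernel.  Such a lift
   is exp_delta(P_0 a) + V^(m+1) (y a), where y : A -> W_(n-1)(B) satisfies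
   equations in the R-algebra C = W_(n-1)(B) that do not mention n: additivity,
   a twisted Leibniz rule, and vanishing on R.  If E is the functor of the
   solutions y : A -> C of these equations, then N^{[m]n} X = J^(n-1) E for
   all n >= 1, and E = N^{[m]1} X is the case n = 1.  The jet spaces of E are
   formal schemes because they are given by equations in a (possibly infinite)
   product of affine lines, hence are affine. *)

Set Implicit Arguments.
Unset Strict Implicit.
Unset Printing Implicit Defensive.

Import GRing.Theory.
Local Open Scope ring_scope.

(** * Quotient rings and localizations *)

(** A commutative ring up to an equivalence relation. Quotients are built once at this level and
    then used twice: for fractions in a localization and for terms that denote convergent power
    series. *)
Record ring_setoid := RingSetoid {
  rs_car :> Type;
  rs_eq : rs_car -> rs_car -> Prop;
  rs0 : rs_car;
  rs1 : rs_car;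
  rsN : rs_car -> rs_car;
  rsD : rs_car -> rs_car -> rs_car;
  rsM : rs_car -> rs_car -> rs_car;
  rs_refl : forall x, rs_eq x x;
  rs_sym : forall x y, rs_eq x y -> rs_eq y x;
  rs_trans : forall x y z, rs_eq x y -> rs_eq y z -> rs_eq x z;
  rsN_eq : forall x x', rs_eq x x' -> rs_eq (rsN x) (rsN x');
  rsD_eq : forall x x' y y', rs_eq x x' -> rs_eq y y' ->
    rs_eq (rsD x y) (rsD x' y');
  rsM_eq : forall x x' y y', rs_eq x x' -> rs_eq y y' ->
    rs_eq (rsM x y) (rsM x' y');
  rsDA : forall x y z, rs_eq (rsD x (rsD y z)) (rsD (rsD x y) z);
  rsDC : forall x y, rs_eq (rsD x y) (rsD y x);
  rs0D : forall x, rs_eq (rsD rs0 x) x;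
  rsND : forall x, rs_eq (rsD (rsN x) x) rs0;
  rsMA : forall x y z, rs_eq (rsM x (rsM y z)) (rsM (rsM x y) z);
  rsMC : forall x y, rs_eq (rsM x y) (rsM y x);
  rs1M : forall x, rs_eq (rsM rs1 x) x;
  rsMDl : forall x y z, rs_eq (rsM (rsD x y) z) (rsD (rsM x z) (rsM y z))
}.

Section RingQuotient.
Variable T : ring_setoid.
Local Notation "x ~~ y" := (@rs_eq T x y) (at level 70).

Definition rs_repr (x : T) : T := @xget {classic T} (rs0 T) (rs_eq x).

Lemma rs_reprP x : x ~~ rs_repr x.
Proof. exact: (@xgetI {classic T} _ (rs_eq x) x (rs_refl x)). Qed.

(** Equivalent elements have extensionally equal classes, so choice picks the same member from
    both. *)
Lemma rs_repr_eq x y : x ~~ y -> rs_repr x = rs_repr y.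
Proof.
move=> xy; rewrite /rs_repr; suff -> : rs_eq x = rs_eq y by [].
apply/funext => z; apply/propext.
by split; apply: rs_trans => //; apply: rs_sym.
Qed.

Lemma rs_repr_id x : rs_repr (rs_repr x) = rs_repr x.
Proof. by apply/esym/rs_repr_eq/rs_reprP. Qed.

Definition quo : Type := {x : T | rs_repr x = x}.
HB.instance Definition _ := gen_eqMixin quo.
HB.instance Definition _ := gen_choiceMixin quo.

Definition qcls (x : T) : quo := exist _ (rs_repr x) (rs_repr_id x).
Definition qrep (z : quo) : T := sval z.

Lemma qrepK z : qcls (qrep z) = z.
Proof. by case: z => x xE; apply: eq_exist. Qed.

Lemma qcls_eq x y : qcls x = qcls y <-> x ~~ y.
Proof.
split=> [/(congr1 (fun z => sval z)) /= e|/rs_repr_eq e]; last exact: eq_exist.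
by apply: rs_trans (rs_reprP x) _; rewrite e; apply/rs_sym/rs_reprP.
Qed.

Lemma qcls_surj (P : quo -> Prop) : (forall x, P (qcls x)) -> forall z, P z.
Proof. by move=> h z; rewrite -[z]qrepK. Qed.

Lemma qrep_cls x : qrep (qcls x) ~~ x.
Proof. by apply/qcls_eq; rewrite qrepK. Qed.

Definition quo_opp z := qcls (rsN (qrep z)).
Definition quo_add z t := qcls (rsD (qrep z) (qrep t)).
Definition quo_mul z t := qcls (rsM (qrep z) (qrep t)).

Lemma quo_oppE x : quo_opp (qcls x) = qcls (rsN x).
Proof. by apply/qcls_eq/rsN_eq/qrep_cls. Qed.
Lemma quo_addE x y : quo_add (qcls x) (qcls y) = qcls (rsD x y).
Proof. by apply/qcls_eq/rsD_eq; exact: qrep_cls. Qed.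
Lemma quo_mulE x y : quo_mul (qcls x) (qcls y) = qcls (rsM x y).
Proof. by apply/qcls_eq/rsM_eq; exact: qrep_cls. Qed.

Lemma quo_addA : associative quo_add.
Proof.
elim/qcls_surj=> x; elim/qcls_surj=> y; elim/qcls_surj=> z.
by rewrite !quo_addE; apply/qcls_eq/rsDA.
Qed.
Lemma quo_addC : commutative quo_add.
Proof.
by elim/qcls_surj=> x; elim/qcls_surj=> y; rewrite !quo_addE; apply/qcls_eq/rsDC.
Qed.
Lemma quo_add0 : left_id (qcls (rs0 T)) quo_add.
Proof. by elim/qcls_surj=> x; rewrite quo_addE; apply/qcls_eq/rs0D. Qed.
Lemma quo_addN : left_inverse (qcls (rs0 T)) quo_opp quo_add.
Proof.
by elim/qcls_surj=> x; rewrite quo_oppE quo_addE; apply/qcls_eq/rsND.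
Qed.
Lemma quo_mulA : associative quo_mul.
Proof.
elim/qcls_surj=> x; elim/qcls_surj=> y; elim/qcls_surj=> z.
by rewrite !quo_mulE; apply/qcls_eq/rsMA.
Qed.
Lemma quo_mulC : commutative quo_mul.
Proof.
by elim/qcls_surj=> x; elim/qcls_surj=> y; rewrite !quo_mulE; apply/qcls_eq/rsMC.
Qed.
Lemma quo_mul1 : left_id (qcls (rs1 T)) quo_mul.
Proof. by elim/qcls_surj=> x; rewrite quo_mulE; apply/qcls_eq/rs1M. Qed.
Lemma quo_mulDl : left_distributive quo_mul quo_add.
Proof.
elim/qcls_surj=> x; elim/qcls_surj=> y; elim/qcls_surj=> z.
by rewrite !(quo_mulE, quo_addE); apply/qcls_eq/rsMDl.
Qed.

HB.instance Definition _ := GRing.isZmodule.Build quo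
  quo_addA quo_addC quo_add0 quo_addN.
HB.instance Definition _ := GRing.Zmodule_isComPzRing.Build quo
  quo_mulA quo_mulC quo_mul1 quo_mulDl.

Lemma qcls0 : qcls (rs0 T) = 0. Proof. by []. Qed.
Lemma qcls1 : qcls (rs1 T) = 1. Proof. by []. Qed.
Lemma qclsN x : qcls (rsN x) = - qcls x.
Proof. by rewrite -quo_oppE. Qed.
Lemma qclsD x y : qcls (rsD x y) = qcls x + qcls y.
Proof. by rewrite -quo_addE. Qed.
Lemma qclsM x y : qcls (rsM x y) = qcls x * qcls y.
Proof. by rewrite -quo_mulE. Qed.

End RingQuotient.

Lemma congrMl (A : comPzRingType) d (a x y : A) :
  congr_mod d x y -> congr_mod d (a * x) (a * y).
Proof. exact: (congrM (congr_refl d a)). Qed.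

(* The localization of B / dB at f, as a quotient of the pairs (b, N), which
   stand for b / f^N. *)
Section Localization.
Variables (B : comPzRingType) (d f : B).

(** The extra factor [f ^+ M] is there because [f] may be a zero divisor modulo [d]; without it the
    relation would not be transitive. *)
Definition loc_eq (x y : B * nat) : Prop :=
  exists M, congr_mod d (f ^+ (M + y.2) * x.1) (f ^+ (M + x.2) * y.1).

Lemma loc_eq_of x y : congr_mod d (f ^+ y.2 * x.1) (f ^+ x.2 * y.1) -> loc_eq x y.
Proof. by exists 0%N. Qed.

Lemma loc_refl x : loc_eq x x.
Proof. by exists 0%N; apply: congr_refl. Qed.

Lemma loc_sym x y : loc_eq x y -> loc_eq y x.
Proof. by case=> M /congr_sym; exists M. Qed.

Lemma loc_trans x y z : loc_eq x y -> loc_eq y z -> loc_eq x z.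
Proof.
case: x y z => [x i] [y j] [z k] [M /= hM] [N /= hN].
exists (M + N + j)%N; rewrite /=.
have -> : f ^+ (M + N + j + k) * x = f ^+ (N + k) * (f ^+ (M + j) * x).
  by rewrite mulrA -exprD; congr (_ ^+ _ * _); lia.
have -> : f ^+ (M + N + j + i) * z = f ^+ (M + i) * (f ^+ (N + j) * z).
  by rewrite mulrA -exprD; congr (_ ^+ _ * _); lia.
apply: congr_trans (congrMl _ hM) _.
rewrite mulrCA; exact: congrMl.
Qed.

Definition loc_opp (x : B * nat) := (- x.1, x.2).
Definition loc_add (x y : B * nat) :=
  (f ^+ y.2 * x.1 + f ^+ x.2 * y.1, (x.2 + y.2)%N).
Definition loc_mul (x y : B * nat) := (x.1 * y.1, (x.2 + y.2)%N).

Lemma loc_opp_eq x x' : loc_eq x x' -> loc_eq (loc_opp x) (loc_opp x').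
Proof. by case=> M h; exists M; rewrite /= !mulrN; apply: congrN. Qed.

Lemma loc_add_eq x x' y y' :
  loc_eq x x' -> loc_eq y y' -> loc_eq (loc_add x y) (loc_add x' y').
Proof.
case: x x' y y' => [x i] [x' i'] [y j] [y' j'] [M /= hM] [N /= hN].
exists (M + N)%N; rewrite /= !mulrDr; apply: congrD.
  have -> : f ^+ (M + N + (i' + j')) * (f ^+ j * x) =
    f ^+ (N + j' + j) * (f ^+ (M + i') * x) by rewrite !exprD; ring.
  have -> : f ^+ (M + N + (i + j)) * (f ^+ j' * x') =
    f ^+ (N + j' + j) * (f ^+ (M + i) * x') by rewrite !exprD; ring.
  exact: congrMl.
have -> : f ^+ (M + N + (i' + j')) * (f ^+ i * y) =
  f ^+ (M + i' + i) * (f ^+ (N + j') * y) by rewrite !exprD; ring.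
have -> : f ^+ (M + N + (i + j)) * (f ^+ i' * y') =
  f ^+ (M + i' + i) * (f ^+ (N + j) * y') by rewrite !exprD; ring.
exact: congrMl.
Qed.

Lemma loc_mul_eq x x' y y' :
  loc_eq x x' -> loc_eq y y' -> loc_eq (loc_mul x y) (loc_mul x' y').
Proof.
case: x x' y y' => [x i] [x' i'] [y j] [y' j'] [M /= hM] [N /= hN].
exists (M + N)%N; rewrite /=.
have -> : f ^+ (M + N + (i' + j')) * (x * y) =
  (f ^+ (M + i') * x) * (f ^+ (N + j') * y) by rewrite !exprD; ring.
have -> : f ^+ (M + N + (i + j)) * (x' * y') =
  (f ^+ (M + i) * x') * (f ^+ (N + j) * y') by rewrite !exprD; ring.
exact: congrM.
Qed.

Ltac loc_ring :=
  rewrite /loc_add /loc_mul /loc_opp /=; apply/loc_eq_of/congr_eq => /=;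
  rewrite ?exprD; ring.

Definition loc_setoid : ring_setoid.
refine (@RingSetoid (B * nat)%type loc_eq (0, 0%N) (1, 0%N) loc_opp loc_add loc_mul
  loc_refl loc_sym loc_trans loc_opp_eq loc_add_eq loc_mul_eq _ _ _ _ _ _ _ _).
- by move=> [x i] [y j] [z k]; loc_ring.
- by move=> [x i] [y j]; loc_ring.
- by move=> [x i]; loc_ring.
- by move=> [x i]; loc_ring.
- by move=> [x i] [y j] [z k]; loc_ring.
- by move=> [x i] [y j]; loc_ring.
- by move=> [x i]; loc_ring.
- by move=> [x i] [y j] [z k]; loc_ring.
Defined.

Definition loc : comPzRingType := quo loc_setoid.
Definition loc_of (b : B) : loc := @qcls loc_setoid (b, 0%N).

Lemma loc_of_zmod : zmod_morphism loc_of.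
Proof.
move=> x y; rewrite /loc_of -qclsN -qclsD; apply/qcls_eq/loc_eq_of/congr_eq => /=.
by rewrite !mul1r.
Qed.

Lemma loc_of_monoid : monoid_morphism loc_of.
Proof. by split=> // x y; rewrite /loc_of -qclsM. Qed.

HB.instance Definition _ := GRing.isZmodMorphism.Build B loc loc_of loc_of_zmod.
HB.instance Definition _ := GRing.isMonoidMorphism.Build B loc loc_of loc_of_monoid.

Lemma loc_of_eq0 b : loc_of b = 0 <-> exists N, congr_mod d (f ^+ N * b) 0.
Proof.
rewrite -(qcls0 loc_setoid) /loc_of qcls_eq.
by split=> -[N]; rewrite /= ?addn0 ?mulr0 => h; exists N => //=; rewrite ?addn0 ?mulr0.
Qed.

Lemma loc_of_unit : exists y : loc, loc_of f * y = 1.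
Proof.
exists (@qcls loc_setoid (1, 1%N)); rewrite /loc_of -qclsM -qcls1.
by apply/qcls_eq/loc_eq_of/congr_eq; rewrite /= expr0 expr1 !mulr1 mul1r.
Qed.

Lemma locP (z : loc) : exists N b, loc_of f ^+ N * z = loc_of b.
Proof.
elim/qcls_surj: z => -[b N]; exists N, b.
have -> : loc_of f ^+ N = loc_of (f ^+ N) by rewrite rmorphXn.
rewrite /loc_of -qclsM; apply/qcls_eq/loc_eq_of/congr_eq => /=.
by rewrite mul1r.
Qed.

Section Lift.
Variables (C : comPzRingType) (g : {rmorphism B -> C}) (u : C).
Hypotheses (gd : g d = 0) (gfu : g f * u = 1).

Definition loc_lift (z : loc) : C := g (qrep z).1 * u ^+ (qrep z).2.

Lemma gfX N : g (f ^+ N) * u ^+ N = 1.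
Proof. by rewrite rmorphXn -exprMn gfu expr1n. Qed.

Lemma loc_lift_eq (x y : B * nat) : loc_eq x y -> g x.1 * u ^+ x.2 = g y.1 * u ^+ y.2.
Proof.
case: x y => [x i] [y j] [M /= [z]] /(congr1 g).
rewrite rmorphM gd mul0r rmorphB => /eqP; rewrite subr_eq0 => /eqP e.
have: g (f ^+ (M + j) * x) * u ^+ (M + i + j) = g (f ^+ (M + i) * y) * u ^+ (M + i + j).
  by rewrite e.
have -> : g (f ^+ (M + j) * x) * u ^+ (M + i + j) =
  g x * u ^+ i * (g (f ^+ M) * u ^+ M) * (g (f ^+ j) * u ^+ j).
  by rewrite rmorphM !exprD rmorphM; ring.
have -> : g (f ^+ (M + i) * y) * u ^+ (M + i + j) =
  g y * u ^+ j * (g (f ^+ M) * u ^+ M) * (g (f ^+ i) * u ^+ i).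
  by rewrite rmorphM !exprD rmorphM; ring.
by rewrite !gfX !mulr1.
Qed.

Lemma loc_liftE x i : loc_lift (@qcls loc_setoid (x, i)) = g x * u ^+ i.
Proof. exact: (loc_lift_eq (qrep_cls (T := loc_setoid) (x, i))). Qed.

Lemma loc_lift_zmod : zmod_morphism loc_lift.
Proof.
elim/qcls_surj=> -[x i]; elim/qcls_surj=> -[y j].
rewrite -qclsN -qclsD !loc_liftE /= mulrN rmorphB !rmorphM exprD mulrBl.
congr (_ - _).
  by rewrite -[RHS]mulr1 -(gfX j); ring.
by rewrite -[RHS]mulr1 -(gfX i); ring.
Qed.

Lemma loc_lift_monoid : monoid_morphism loc_lift.
Proof.
split=> [|]; first by rewrite -qcls1 loc_liftE rmorph1 mulr1.
elim/qcls_surj=> -[x i]; elim/qcls_surj=> -[y j].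
by rewrite -qclsM !loc_liftE /= rmorphM exprD; ring.
Qed.

Definition loc_lift_rmorphism : {rmorphism loc -> C} :=
  HB.pack loc_lift (GRing.isZmodMorphism.Build loc C loc_lift loc_lift_zmod)
    (GRing.isMonoidMorphism.Build loc C loc_lift loc_lift_monoid).

Lemma loc_lift_of b : loc_lift (loc_of b) = g b.
Proof. by rewrite loc_liftE mulr1. Qed.

End Lift.
End Localization.

(** * Completed localizations *)

Section Adic.
Variables (A : comPzRingType) (d : A).

Lemma congr_telescope (u : nat -> A) i j :
  (forall k, congr_mod (d ^+ k) (u k.+1) (u k)) -> (i <= j)%N ->
  congr_mod (d ^+ i) (u j) (u i).
Proof.
move=> hu; elim: j => [|j IH]; first by rewrite leqn0 => /eqP ->; apply: congr_refl.
rewrite leq_eqVlt => /predU1P[->|]; first exact: congr_refl.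
rewrite ltnS => ij; apply: congr_trans (IH ij).
exact: congr_le ij (hu j).
Qed.

Lemma congr_mod0 (x y : A) : congr_mod 0 x y <-> x = y.
Proof.
split=> [[z]|->]; last exact: congr_refl.
by rewrite mul0r => /eqP; rewrite subr_eq0 => /eqP.
Qed.

Lemma congr_subr0 (e x y : A) : congr_mod e (x - y) 0 <-> congr_mod e x y.
Proof. by split=> -[z]; rewrite ?subr0 => h; exists z; rewrite ?subr0. Qed.

Lemma adically_complete_nilpotent k : d ^+ k = 0 -> adically_complete d.
Proof.
move=> dk; split=> [x /(_ k)|u hu]; first by rewrite dk => /congr_mod0.
(* From index [k] on the sequence is constant, since [d ^+ k = 0]; its limit is therefore [u k]. *)
exists (u k) => j; have [jk|/ltnW kj] := leqP j k; first exact: congr_telescope.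
by have := congr_telescope hu kj; rewrite dk => /congr_mod0 ->; apply: congr_refl.
Qed.

Lemma adic_separated (x y : A) : adically_complete d ->
  (forall k, congr_mod (d ^+ k) x y) -> x = y.
Proof.
case=> sep _ h; apply/eqP; rewrite -subr_eq0; apply/eqP/sep => k.
exact/congr_subr0.
Qed.

End Adic.

Lemma congr_rmorph (A B : comPzRingType) (f : {rmorphism A -> B}) d x y :
  congr_mod d x y -> congr_mod (f d) (f x) (f y).
Proof. by case=> z e; exists (f z); rewrite -rmorphB e rmorphM. Qed.

Lemma ideal_gen_is_ideal (A : comPzRingType) (E : set A) : is_ideal (ideal_gen E).
Proof.
split=> [|x y [s [sE ->]] [t [tE ->]]|a x [s [sE ->]]].
- by exists [::]; rewrite big_nil.
- exists (s ++ t); split; last by rewrite big_cat.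
  by move=> c; rewrite mem_cat => /orP[/sE|/tE].
exists [seq (a * c.1, c.2) | c <- s]; split=> [_ /mapP[c /sE cE ->] //|].
by rewrite big_map mulr_sumr; apply: eq_bigr => c _; rewrite mulrA.
Qed.

Lemma ideal_gen_sub (A : comPzRingType) (E I : set A) : is_ideal I ->
  (forall x, E x -> I x) -> forall x, ideal_gen E x -> I x.
Proof.
move=> [I0 ID IM] EI x [s [sE ->]]; elim: s sE => [|c s IH] sE.
  by rewrite big_nil.
rewrite big_cons; apply: ID; first exact/IM/EI/sE/mem_head.
by apply: IH => e es; apply: sE; rewrite in_cons es orbT.
Qed.

Lemma ideal_gen_mem (A : comPzRingType) (E : set A) x : E x -> ideal_gen E x.
Proof.
move=> Ex; exists [:: (1, x)]; split; last by rewrite big_seq1 mul1r.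
by move=> c; rewrite inE => /eqP ->.
Qed.

Lemma ideal_bigsum (A : comPzRingType) (I : set A) (J : Type) (r : seq J)
    (P : pred J) (F : J -> A) :
  is_ideal I -> (forall j, P j -> I (F j)) -> I (\sum_(j <- r | P j) F j).
Proof. by move=> [I0 ID _] h; elim/big_ind: _ => //; exact: ID. Qed.

Lemma ideal_ord_gen (A : comPzRingType) r (f : 'I_r -> A) x :
  ideal_gen [set f i | i in setT] x -> exists c : 'I_r -> A, x = \sum_i c i * f i.
Proof.
apply: (ideal_gen_sub (I := fun x => exists c : 'I_r -> A, x = \sum_i c i * f i)).
  split=> [|_ _ [a ->] [b ->]|a _ [b ->]].
  - by exists (fun=> 0); rewrite big1 // => i _; rewrite mul0r.
  - exists (fun i => a i + b i); rewrite -big_split.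
    by apply: eq_bigr => i _; rewrite mulrDl.
  - by exists (fun i => a * b i); rewrite mulr_sumr; apply: eq_bigr => i _; rewrite mulrA.
move=> _ [i _ <-]; exists (fun j => (i == j)%:R).
rewrite (bigD1 i) //= eqxx mul1r big1 ?addr0 // => j ji.
by rewrite eq_sym (negPf ji) mul0r.
Qed.

(* The elements some power of which lies in an ideal are closed under sums. *)
Lemma unimodular_exp (A : comPzRingType) r (f : 'I_r -> A) N :
  ideal_gen [set f i | i in setT] 1 ->
  ideal_gen [set f i ^+ N | i in setT] 1.
Proof.
case/ideal_ord_gen => c ec; set J := ideal_gen _.
have [J0 JD JM] : is_ideal J by exact: ideal_gen_is_ideal.
suff [M] : exists M, J ((\sum_i c i * f i) ^+ M) by rewrite -ec expr1n.
elim/big_ind: _ => [|x y [i Ji] [j Jj]|i _].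
- by exists 1%N; rewrite expr0n.
- exists (i + j)%N; rewrite exprDn; apply: ideal_bigsum => // k _.
  rewrite -mulr_natl; apply: (JM).
  have [ki|ik] := leqP i (i + j - k)%N.
    by rewrite -(subnK ki) exprD mulrAC; apply: (JM).
  have kj : (j <= k)%N by have := ltn_ord k; lia.
  by rewrite -(subnK kj) exprD mulrA; apply: (JM).
by exists N; rewrite exprMn; apply/JM/ideal_gen_mem; exists i.
Qed.

Section CompletedLocalization.
Variables (K : base_prime) (S : delta_dvr K).
Local Notation R := (dR S).
Local Notation calg := (calg S).

Section LocAlgebra.
Variables (B : calg) (k : nat) (f : B).
Local Notation d := (wpi B ^+ k).

Definition loc_ralg : ralg S := RAlg (loc_of d f \o str B : {rmorphism R -> loc d f}).

Lemma loc_wpiX : wpi loc_ralg ^+ k = 0.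
Proof.
transitivity (loc_of d f (wpi B ^+ k)); first by rewrite rmorphXn.
apply/loc_of_eq0; exists 0%N.
by rewrite mul1r; exists 1; rewrite subr0 mulr1.
Qed.

(** Since pi is nilpotent in the localization of [B / pi^k], this algebra is complete, hence an
    admissible target for the universal property of the completed localization. *)
Lemma loc_complete : adically_complete (wpi loc_ralg).
Proof. exact: adically_complete_nilpotent loc_wpiX. Qed.

Definition loc_calg : calg := CAlg loc_complete.
Definition loc_rhom : rhom B loc_calg :=
  @RHom K S B loc_calg (loc_of d f) (fun=> erefl).
End LocAlgebra.

Variables (B L : calg) (f : B) (l : rhom B L).
Hypothesis fl : is_completed_localization f l.

(** The universal property gives a map from [L] to [(B / pi^k)_f] over [B]. It kills [pi^k], so [b]
    vanishes in [(B / pi^k)_f], that is, a power of [f] kills it modulo [pi^k]. *)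
Lemma cloc_eq0 k b : congr_mod (wpi L ^+ k) (l b) 0 ->
  exists N, congr_mod (wpi B ^+ k) (f ^+ N * b) 0.
Proof.
have [h [hl _]] := fl.2 (loc_calg k f) (loc_rhom k f) (loc_of_unit _ _).
move/(congr_rmorph h); rewrite rmorph0 hl rmorphXn (rhom_wpi h).
by rewrite loc_wpiX => /congr_mod0 lb0; apply/loc_of_eq0.
Qed.

(** The reduction [L -> L / pi^k] factors through [(B / pi^k)_f], by uniqueness in the universal
    property. So modulo [pi^k] every element of [L] is a fraction [b / f^N]. *)
Lemma cloc_dense k y : exists N b, congr_mod (wpi L ^+ k) (l f ^+ N * y) (l b).
Proof.
have [[v fv] univ] := fl.
have [h [hl _]] := univ (loc_calg k f) (loc_rhom k f) (loc_of_unit _ _).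
(* Localizing at 1 inverts nothing new: [D] is [L / pi^k] and [p] is the reduction. *)
pose D := loc_calg k (1 : L); pose p : rhom L D := loc_rhom k (1 : L).
have p_eq0 x : p x = 0 -> congr_mod (wpi L ^+ k) x 0.
  by case/loc_of_eq0 => N; rewrite expr1n mul1r.
have gd : rcomp p l (wpi B ^+ k) = 0.
  by rewrite rmorphXn (rhom_wpi (rcomp p l)) loc_wpiX.
have gu : rcomp p l f * p v = 1 by rewrite /= -rmorphM fv rmorph1.
have strP r : loc_lift (rcomp p l) (p v) (str (loc_calg k f) r) = str D r.
  by rewrite /= (loc_lift_of gd gu) /= rhom_str.
pose q : rhom (loc_calg k f) D :=
  @RHom K S (loc_calg k f) D (loc_lift_rmorphism gd gu) strP.
have [h' [_ uniq]] := univ D (rcomp p l) (ex_intro _ _ gu).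
have qh : rcomp q h = p.
  rewrite [RHS]uniq //; apply: uniq => b /=.
  by rewrite hl /= (loc_lift_of gd gu).
have [N [b e]] := locP (h y).
exists N, b; apply/congr_subr0/p_eq0; rewrite rmorphB; apply/eqP; rewrite subr_eq0.
have := congr1 q e; rewrite rmorphM rmorphXn.
have -> : q (h y) = p y by rewrite -qh.
have -> : q (loc_of _ _ f) = p (l f) by rewrite /= (loc_lift_of gd gu).
have -> : q (loc_of _ _ b) = p (l b) by rewrite /= (loc_lift_of gd gu).
by rewrite rmorphM rmorphXn => ->.
Qed.

End CompletedLocalization.

(** * Gluing *)

Lemma finite_uniform (I : finType) (P : I -> nat -> Prop) :
  (forall i, exists N, P i N) -> (forall i N M, P i N -> (N <= M)%N -> P i M) ->
  exists N, forall i, P i N.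
Proof.
move=> hP mono; exists (\max_i projT1 (cid (hP i))) => i.
exact: mono (projT2 (cid (hP i))) (leq_bigmax i).
Qed.

Lemma congr0_exp_le (A : comPzRingType) d (f x : A) N M :
  congr_mod d (f ^+ N * x) 0 -> (N <= M)%N -> congr_mod d (f ^+ M * x) 0.
Proof.
move=> h /subnK <-; rewrite exprD -mulrA -[0](mulr0 (f ^+ (M - N))).
exact: congrMl.
Qed.

Section Gluing.
Variables (K : base_prime) (S : delta_dvr K) (B : calg S) (r : nat) (f : 'I_r -> B).
Hypothesis f1 : ideal_gen [set f i | i in setT] 1.
Variables (L : 'I_r -> calg S) (l : forall i, rhom B (L i)).
Hypothesis hl : forall i, is_completed_localization (f i) (l i).

Lemma unimodular_congr N d x :
  (forall i, congr_mod d (f i ^+ N * x) 0) -> congr_mod d x 0.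
Proof.
move=> h; have [c ec] := ideal_ord_gen (unimodular_exp N f1).
rewrite -[x]mul1r ec mulr_suml; apply: congr_sum0 => i _.
by rewrite -mulrA -[0](mulr0 (c i)); apply: congrMl.
Qed.

(** On each piece a power of [f i] kills [b] modulo [pi^k]. There are finitely many pieces, so one
    exponent serves all, and the powers [f i ^+ N] still generate the unit ideal. *)
Lemma congr0_locally k b :
  (forall i, congr_mod (wpi (L i) ^+ k) (l i b) 0) -> congr_mod (wpi B ^+ k) b 0.
Proof.
move=> h; have [N hN] : exists N, forall i, congr_mod (wpi B ^+ k) (f i ^+ N * b) 0.
  apply: finite_uniform => [i|i N M]; first exact: (cloc_eq0 (hl i) (h i)).
  exact: congr0_exp_le.
exact: unimodular_congr hN.
Qed.

Variables (L2 : 'I_r -> 'I_r -> calg S) (l2 : forall i j, rhom B (L2 i j)).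
Hypothesis hl2 : forall i j, is_completed_localization (f i * f j) (l2 i j).
Variables (a1 : forall i j, rhom (L i) (L2 i j)) (a2 : forall i j, rhom (L j) (L2 i j)).
Hypothesis ha1 : forall i j b, a1 i j (l i b) = l2 i j b.
Hypothesis ha2 : forall i j b, a2 i j (l j b) = l2 i j b.
Variable y : forall i, L i.
Hypothesis hy : forall i j, a1 i j (y i) = a2 i j (y j).

Lemma common_denominator k : exists N, forall i, exists b,
  congr_mod (wpi (L i) ^+ k) (l i (f i) ^+ N * y i) (l i b).
Proof.
apply: finite_uniform => [i|i N M [b hb] /subnK <-]; first exact: cloc_dense.
exists (f i ^+ (M - N) * b).
by rewrite exprD -mulrA rmorphM rmorphXn; apply: congrMl.
Qed.

(** The classical gluing of fractions, modulo [pi^k]: write [y i = b i / f i ^+ N] with a common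
    [N], clear the discrepancies on the overlaps with a common power [M], and patch with a partition
    of unity. *)
Lemma glue_mod k : exists b, forall i, congr_mod (wpi (L i) ^+ k) (l i b) (y i).
Proof.
have [N hN] := common_denominator k.
pose b i := projT1 (cid (hN i)).
have hb i : congr_mod (wpi (L i) ^+ k) (l i (f i) ^+ N * y i) (l i (b i)).
  exact: projT2 (cid (hN i)).
have hbb i j : congr_mod (wpi (L2 i j) ^+ k)
    (l2 i j (f j ^+ N * b i - f i ^+ N * b j)) 0.
  rewrite rmorphB; apply/congr_subr0; rewrite !rmorphM.
  have e1 := congr_rmorph (a1 i j) (hb i); have e2 := congr_rmorph (a2 i j) (hb j).
  move: e1 e2; rewrite !rmorphM !rmorphXn !rhom_wpi !ha1 !ha2 hy => e1 e2.
  apply: congr_trans (congrMl _ (congr_sym e1)) _; rewrite mulrCA.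
  exact: congrMl.
have [M hM] : exists M, forall ij : 'I_r * 'I_r, congr_mod (wpi B ^+ k)
    ((f ij.1 * f ij.2) ^+ M * (f ij.2 ^+ N * b ij.1 - f ij.1 ^+ N * b ij.2)) 0.
  apply: finite_uniform => [[i j]|ij M M']; last exact: congr0_exp_le.
  exact: (cloc_eq0 (hl2 i j) (hbb i j)).
have [c ec] := ideal_ord_gen (unimodular_exp (N + M) f1).
have key i j : congr_mod (wpi B ^+ k)
    (f j ^+ (N + M) * (f i ^+ M * b i)) (f i ^+ (N + M) * (f j ^+ M * b j)).
  apply/congr_subr0; have := hM (i, j); rewrite /=; congr congr_mod.
  by rewrite exprMn !exprD; ring.
(* As [c] satisfies [1 = \sum_j c j * f j ^+ (N + M)], multiplying this sum by [f i ^+ (N + M)] and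
   applying [key] termwise gives back [f i ^+ M * b i]. *)
exists (\sum_j c j * (f j ^+ M * b j)) => i.
have h : congr_mod (wpi B ^+ k) (f i ^+ (N + M) * \sum_j c j * (f j ^+ M * b j))
    (f i ^+ M * b i).
  rewrite -[X in congr_mod _ _ X]mul1r ec mulr_sumr mulr_suml.
  apply: congr_sum => j _; rewrite mulrCA -[X in congr_mod _ _ X]mulrA.
  exact/congrMl/congr_sym.
have [v fv] := (hl i).1.
move: (congr_rmorph (l i) h); rewrite !rmorphM !rmorphXn rhom_wpi => {}h.
have {}h := congr_trans h (congrMl _ (congr_sym (hb i))).
have := congrMl (v ^+ (N + M)) h.
have vX : (l i (f i) * v) ^+ (N + M) = 1 by rewrite fv expr1n.
set F := l i (f i) in h vX *; set s := l i (\sum_j _).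
have -> : v ^+ (N + M) * (F ^+ (N + M) * s) = s.
  by rewrite -[RHS]mul1r -vX exprMn; ring.
suff -> : v ^+ (N + M) * (F ^+ M * (F ^+ N * y i)) = y i by [].
by rewrite -[RHS]mul1r -vX exprMn !exprD; ring.
Qed.

(** The solutions modulo successive powers of pi are compatible, because congruences can be tested
    locally; completeness of [B] gives the limit and separatedness its uniqueness. *)
Lemma glue : exists b, (forall i, l i b = y i) /\
  forall b', (forall i, l i b' = y i) -> b' = b.
Proof.
pose b k := projT1 (cid (glue_mod k)).
have hb k i : congr_mod (wpi (L i) ^+ k) (l i (b k)) (y i).
  exact: (projT2 (cid (glue_mod k)) i).
have [b0 h0] : exists b0, forall k, congr_mod (wpi B ^+ k) b0 (b k).
  apply: (calg_complete B).2 => k; apply/congr_subr0/congr0_locally => i.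
  rewrite rmorphB; apply/congr_subr0; apply: congr_trans (congr_sym (hb k i)).
  exact: congr_le (leqnSn k) (hb k.+1 i).
have lb0 i : l i b0 = y i.
  apply: (adic_separated (calg_complete (L i))) => k.
  apply: congr_trans (hb k i); rewrite -(rhom_wpi (l i)) -rmorphXn.
  exact: congr_rmorph.
exists b0; split=> // b' hb'; apply: (adic_separated (calg_complete B)) => k.
apply/congr_subr0/congr0_locally => i.
by rewrite rmorphB hb' lb0 subrr; apply: congr_refl.
Qed.

End Gluing.

(** * Representable presheaves are affine formal schemes *)

Section Representable.
Variables (K : base_prime) (S : delta_dvr K).

Definition represents (X : presheaf S) (Q : calg S) (u : X Q) : Prop :=
  forall (B : calg S) (x : X B), exists h : rhom Q B,
    act h u = x /\ forall h' : rhom Q B, act h' u = x -> h' = h.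

Lemma rhom_glue (Q B : calg S) (I : Type) (L : I -> calg S)
    (l : forall i, rhom B (L i)) (x : forall i, rhom Q (L i)) (y : Q -> B) :
  (forall b b', (forall i, l i b = l i b') -> b = b') ->
  (forall i a, l i (y a) = x i a) -> exists h : rhom Q B, forall a, h a = y a.
Proof.
move=> inj hy.
have yB : zmod_morphism y by move=> a a'; apply: inj => i; rewrite rmorphB !hy rmorphB.
have yM : monoid_morphism y.
  by split=> [|a a']; apply: inj => i; rewrite ?rmorphM !hy ?rmorph1 ?rmorphM.
have yS t : y (str Q t) = str B t by apply: inj => i; rewrite hy !rhom_str.
by exists (@RHom K S Q B (HB.pack y (GRing.isZmodMorphism.Build Q B y yB)
  (GRing.isMonoidMorphism.Build Q B y yM) : {rmorphism Q -> B}) yS).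
Qed.

Lemma zariski_sheaf_Spf (Q : calg S) : zariski_sheaf (Spf Q).
Proof.
move=> B r f f1 L l hl L2 l2 hl2 a1 a2 ha1 ha2 x hx.
have gl a := glue f1 hl hl2 ha1 ha2 (y := fun i => x i a)
  (fun i j => congr1 (fun g : rhom Q (L2 i j) => g a) (hx i j)).
have inj b b' : (forall i, l i b = l i b') -> b = b'.
  move=> e; apply: (adic_separated (calg_complete B)) => k.
  apply/congr_subr0/(congr0_locally f1 hl) => i.
  by rewrite rmorphB e subrr; apply: congr_refl.
pose y a := projT1 (cid (gl a)).
have hy i a : l i (y a) = x i a by exact: (projT2 (cid (gl a))).1.
have [h hE] := rhom_glue inj hy.
exists h; split=> [i|h' hh']; apply: rhom_ext => a; first by rewrite /= hE hy.
by apply: inj => i; rewrite hE hy -hh'.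
Qed.

Lemma represents_formal_scheme (X : presheaf S) (Q : calg S) (u : X Q) :
  represents u -> formal_scheme X.
Proof.
move=> hu.
pose g (B : calg S) (x : X B) : rhom Q B := projT1 (cid (hu B x)).
have gK (B : calg S) (x : X B) : act (g B x) u = x by exact: (projT2 (cid (hu B x))).1.
have g_uniq (B : calg S) (x : X B) (h : rhom Q B) : act h u = x -> h = g B x.
  exact: (projT2 (cid (hu B x))).2.
have g_act (B C : calg S) (h : rhom B C) (x : X B) : g C (act h x) = rcomp h (g B x).
  by apply/esym/g_uniq; rewrite act_comp gK.
split.
  move=> B r f f1 L l hl L2 l2 hl2 a1 a2 ha1 ha2 x hx.
  have [|h [hl_ uniq]] := @zariski_sheaf_Spf Q B r f f1 L l hl L2 l2 hl2 a1 a2 ha1 ha2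
    (fun i => g _ (x i)).
    by move=> i j; rewrite /= -!g_act hx.
  exists (act h u); split=> [i|y hy]; first by rewrite -act_comp [rcomp _ _]hl_ gK.
  by rewrite -(uniq (g _ y)) ?gK // => i; rewrite /= -g_act hy.
have jact (B C : calg S) (f : rhom B C) (h : Spf Q B) :
    act (rcomp f h) u = act f (act h u).
  exact: act_comp.
exists unit, (fun=> Q), (fun=> @Morphism K S (Spf Q) X (fun B h => act h u) jact).
split=> [_ B h h' /= e|B x].
  by rewrite (g_uniq _ _ _ e); apply/esym/g_uniq.
(* The single chart is all of [X], so its inverse image in any [Spf B] is the open set defined by
   the unit ideal. *)
exists (fun _ e => e = 1); split=> [_ C h|]; last first.
  by apply: ideal_gen_mem; exists tt.
split=> _; first by apply: ideal_gen_mem; exists 1; rewrite ?rmorph1.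
by exists (g C (act h x)); rewrite /= gK.
Qed.

End Representable.

(** * Representability *)

Section Series.
Variables (K : base_prime) (S : delta_dvr K).
Implicit Types B C : calg S.

Definition psum (B : calg S) (u : nat -> B) k : B := \sum_(i < k) wpi B ^+ i * u i.

Lemma psum_congr B (u : nat -> B) k : congr_mod (wpi B ^+ k) (psum u k.+1) (psum u k).
Proof. by exists (u k); rewrite /psum big_ord_recr addrC addKr. Qed.

Definition series (B : calg S) (u : nat -> B) : B :=
  projT1 (cid ((calg_complete B).2 _ (psum_congr u))).

Lemma seriesP B (u : nat -> B) k : congr_mod (wpi B ^+ k) (series u) (psum u k).
Proof. exact: (projT2 (cid ((calg_complete B).2 _ (psum_congr u)))). Qed.

Lemma series_uniq B (u : nat -> B) y :
  (forall k, congr_mod (wpi B ^+ k) y (psum u k)) -> y = series u.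
Proof.
move=> h; apply: (adic_separated (calg_complete B)) => k.
exact: congr_trans (h k) (congr_sym (seriesP u k)).
Qed.

Lemma psum_rmorph B C (h : rhom B C) (u : nat -> B) k :
  h (psum u k) = psum (fun i => h (u i)) k.
Proof.
by rewrite rmorph_sum; apply: eq_bigr => i _; rewrite rmorphM rmorphXn rhom_wpi.
Qed.

Lemma series_rmorph B C (h : rhom B C) (u : nat -> B) :
  h (series u) = series (fun i => h (u i)).
Proof.
apply: series_uniq => k; rewrite -psum_rmorph -(rhom_wpi h) -rmorphXn.
exact: congr_rmorph (seriesP u k).
Qed.

Lemma series_shift B (u : nat -> B) k :
  series u = psum u k + wpi B ^+ k * series (fun j => u (k + j)%N).
Proof.
apply: (adic_separated (calg_complete B)) => n.
apply: congr_trans (congr_le (leq_addl k n) (seriesP u (k + n))) _.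
have -> : psum u (k + n) = psum u k + wpi B ^+ k * psum (fun j => u (k + j)%N) n.
  rewrite /psum big_split_ord; congr (_ + _); rewrite mulr_sumr.
  by apply: eq_bigr => i _; rewrite /= exprD mulrA.
apply: congrD; first exact: congr_refl.
exact/congrMl/congr_sym/seriesP.
Qed.

End Series.

Inductive term (R I : Type) : Type :=
| Gen of I
| Cst of R
| Opp of term R I
| Add of term R I & term R I
| Mul of term R I & term R I
| Ser of (nat -> term R I).

(* A presheaf cut out of a product of affine lines by equations between
   convergent power series is representable: the representing algebra is the
   set of the formal expressions in the coordinates, identified when they take
   the same value at every point.  The constructor Ser, for sums of the form
   u_0 + pi u_1 + pi^2 u_2 + ..., makes this algebra complete. *)
Section Equational.
Variables (K : base_prime) (S : delta_dvr K).
Local Notation R := (dR S).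
Variables (X : presheaf S) (I : Type) (c : forall B : calg S, X B -> I -> B).
Hypothesis c_act : forall (B C : calg S) (h : rhom B C) (x : X B) i,
  c (act h x) i = h (c x i).
Hypothesis c_inj : forall (B : calg S) (x x' : X B), c x =1 c x' -> x = x'.
(** This says that [X] is cut out by equations. The maps [h] that send [v] to the coordinates of a
    point are assumed jointly injective; every equation between coordinates holds after each such
    [h], hence holds for [v] itself, and [v] has to be a point. *)
Hypothesis c_eqn : forall (Q : calg S) (v : I -> Q),
  (forall a b : Q, (forall (B : calg S) (h : rhom Q B) (x : X B),
     (forall i, c x i = h (v i)) -> h a = h b) -> a = b) ->
  exists x : X Q, c x =1 v.

Local Notation term := (term R I).

Fixpoint eval (B : calg S) (x : X B) (t : term) : B :=
  match t with
  | Gen i => c x i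
  | Cst r => str B r
  | Opp t => - eval x t
  | Add t t' => eval x t + eval x t'
  | Mul t t' => eval x t * eval x t'
  | Ser u => series (fun k => eval x (u k))
  end.

Definition term_eq (t t' : term) : Prop :=
  forall (B : calg S) (x : X B), eval x t = eval x t'.

Definition term_setoid : ring_setoid.
refine (@RingSetoid term term_eq (Cst I 0) (Cst I 1) (@Opp R I) (@Add R I) (@Mul R I)
  _ _ _ _ _ _ _ _ _ _ _ _ _ _) => //.
- by move=> t t' e B x; rewrite e.
- by move=> t t' t'' e e' B x; rewrite e e'.
- by move=> t t' e B x /=; rewrite e.
- by move=> t t' s s' e e' B x /=; rewrite e e'.
- by move=> t t' s s' e e' B x /=; rewrite e e'.
- by move=> t t' t'' B x /=; rewrite addrA.
- by move=> t t' B x /=; rewrite addrC.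
- by move=> t B x /=; rewrite rmorph0 add0r.
- by move=> t B x /=; rewrite rmorph0 addNr.
- by move=> t t' t'' B x /=; rewrite mulrA.
- by move=> t t' B x /=; rewrite mulrC.
- by move=> t B x /=; rewrite rmorph1 mul1r.
- by move=> t t' t'' B x /=; rewrite mulrDl.
Defined.

Local Notation cls := (@qcls term_setoid).
Definition tring : comPzRingType := quo term_setoid.
Definition tcst (r : R) : tring := cls (Cst I r).

Lemma tcst_zmod : zmod_morphism tcst.
Proof.
move=> r r'; rewrite /tcst -qclsN -qclsD; apply/qcls_eq => B x /=.
by rewrite rmorphB.
Qed.
Lemma tcst_monoid : monoid_morphism tcst.
Proof.
split=> // r r'; rewrite /tcst -qclsM; apply/qcls_eq => B x /=.
by rewrite rmorphM.
Qed.
HB.instance Definition _ := GRing.isZmodMorphism.Build R tring tcst tcst_zmod.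
HB.instance Definition _ := GRing.isMonoidMorphism.Build R tring tcst tcst_monoid.

Definition tralg : ralg S := RAlg (tcst : {rmorphism R -> tring}).

Section Evaluation.
Variables (B : calg S) (x : X B).
Definition teval (z : tring) : B := eval x (qrep z).

Lemma teval_cls t : teval (cls t) = eval x t.
Proof. exact: (qrep_cls (T := term_setoid) t). Qed.

Lemma teval_zmod : zmod_morphism teval.
Proof.
by elim/qcls_surj=> t; elim/qcls_surj=> t'; rewrite -qclsN -qclsD !teval_cls.
Qed.
Lemma teval_monoid : monoid_morphism teval.
Proof.
split=> [|]; first by rewrite -qcls1 teval_cls /= rmorph1.
by elim/qcls_surj=> t; elim/qcls_surj=> t'; rewrite -qclsM !teval_cls.
Qed.
HB.instance Definition _ := GRing.isZmodMorphism.Build tring B teval teval_zmod.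
HB.instance Definition _ := GRing.isMonoidMorphism.Build tring B teval teval_monoid.

Definition teval_rhom : rhom tralg B :=
  @RHom K S tralg B (teval : {rmorphism tring -> B}) (fun r => teval_cls (Cst I r)).
End Evaluation.

Lemma teval_inj (z z' : tring) :
  (forall (B : calg S) (x : X B), teval x z = teval x z') -> z = z'.
Proof.
elim/qcls_surj: z => t; elim/qcls_surj: z' => t' e; apply/qcls_eq => B x.
by have := e B x; rewrite !teval_cls.
Qed.

Definition tser (u : nat -> tring) : tring := cls (Ser (fun k => qrep (u k))).

Lemma teval_ser (B : calg S) (x : X B) u :
  teval x (tser u) = series (fun k => teval x (u k)).
Proof. exact: teval_cls. Qed.

Lemma tralg_complete : adically_complete (wpi tralg).
Proof.
split=> [z hz|u hu].
  apply: teval_inj => B x; rewrite raddf0.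
  apply: (adic_separated (calg_complete B)) => k.
  rewrite -(rhom_wpi (teval_rhom x)) -rmorphXn -(rmorph0 (teval_rhom x)).
  exact: (congr_rmorph (teval_rhom x)) (hz k).
pose v k := projT1 (cid (hu k)).
have hv k : u k.+1 - u k = wpi tralg ^+ k * v k by exact: projT2 (cid (hu k)).
(* As [u k.+1 - u k = pi^k * v k], the limit is a telescoping series, and its tail from index [k] is
   the quotient that witnesses the congruence modulo [pi^k]. *)
exists (u 0%N + tser v) => k; exists (tser (fun j => v (k + j)%N)).
apply: teval_inj => B x.
have uk : teval x (u k) = teval x (u 0%N) + psum (fun j => teval x (v j)) k.
  elim: k => [|k IH]; first by rewrite /psum big_ord0 addr0.
  have := congr1 (teval_rhom x) (hv k).
  rewrite rmorphB rmorphM rmorphXn rhom_wpi => /eqP; rewrite subr_eq => /eqP /= ->.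
  by rewrite IH /psum big_ord_recr /=; ring.
have := rhom_wpi (teval_rhom x); rewrite /= => wE.
rewrite rmorphB rmorphD rmorphM rmorphXn /= wE !teval_ser uk.
by rewrite (series_shift _ k); ring.
Qed.

Definition tcalg : calg S := CAlg tralg_complete.
Definition tgen (i : I) : tcalg := cls (Gen R i).

Lemma equational_represents : exists u : X tcalg, represents u.
Proof.
have [u hu] : exists u : X tcalg, c u =1 tgen.
  apply: c_eqn => a b h; apply: teval_inj => B x.
  by apply: (h B (teval_rhom x) x) => i; rewrite /= teval_cls.
exists u => B x; exists (teval_rhom x : rhom tcalg B); split.
  by apply: c_inj => i; rewrite c_act hu /= teval_cls.
(* Uniqueness by induction on terms: [h'] is forced on generators and constants, and homomorphisms
   between complete algebras commute with series. *)
move=> h' hx; apply: rhom_ext; elim/qcls_surj=> /= t; rewrite teval_cls.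
elim: t => [i|r|t IH|t IH t' IH'|t IH t' IH'|s IH] /=.
- by rewrite -hx c_act hu.
- exact: (rhom_str h').
- by rewrite qclsN rmorphN IH.
- by rewrite qclsD rmorphD IH IH'.
- by rewrite qclsM rmorphM IH IH'.
(* The formal series is the actual limit in the completed algebra of terms, as evaluation at every
   point shows. *)
have -> : cls (Ser s) = series (fun k => cls (s k) : tcalg).
  apply: teval_inj => B' x'; rewrite teval_cls /=.
  have := series_rmorph (teval_rhom x' : rhom tcalg B') (fun k => cls (s k)).
  by move=> /= ->; congr series; apply/funext => k; rewrite teval_cls.
apply: etrans (series_rmorph (h' : rhom tcalg B) _) _.
by congr series; apply/funext.
Qed.

End Equational.

(** * Verschiebung and Frobenius *)

Section WittComplements.
Variables (K : base_prime) (S : delta_dvr K).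
Local Notation R := (dR S).
Local Notation w := (dpi S).
Local Notation q := (res_card K).

Lemma wstr_map (B C : ralg S) n (f : rhom B C) r : wmap f (wstr B n r) = wstr C n r.
Proof. exact: witt_map_str. Qed.

Lemma wmapD (B C : ralg S) n (f : rhom B C) (x y : witt B n) :
  wmap f (x + y) = wmap f x + wmap f y.
Proof. exact: wmap_add. Qed.

Lemma wmapM (B C : ralg S) n (f : rhom B C) (x y : witt B n) :
  wmap f (x * y) = wmap f x * wmap f y.
Proof. exact: wmap_mul. Qed.

Lemma ghostwD (B : ralg S) n (x y : witt B n) k : (k <= n)%N ->
  ghostw (x + y) k = ghostw x k + ghostw y k.
Proof. exact: ghostw_add. Qed.

Lemma ghostwM (B : ralg S) n (x y : witt B n) k : (k <= n)%N ->
  ghostw (x * y) k = ghostw x k * ghostw y k.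
Proof. exact: ghostw_mul. Qed.

Section Verschiebung.
Variables (m n : nat).
Implicit Types B C : ralg S.

(** The iterated Verschiebung [V^(m+1)] from [W_n] to [W_(m+n+1)], whose image is the kernel of
    truncation to [W_m]. Its ghost components are [m + 1] zeros followed by [pi^(m+1)] times those
    of [y]. *)
Definition vers B (y : witt B n) : witt B (m + n.+1) :=
  wmk (m + n.+1) (fun k => if (k <= m)%N then 0 else wcoef y (k - m.+1)).

Lemma wcoef_vers_low B (y : witt B n) k : (k <= m)%N -> wcoef (vers y) k = 0.
Proof. by move=> km; rewrite wcoef_mk ?km // (leq_trans km) ?leq_addr. Qed.

Lemma wcoef_vers_high B (y : witt B n) k : (k <= n)%N ->
  wcoef (vers y) (m.+1 + k) = wcoef y k.
Proof.
move=> kn; rewrite wcoef_mk; last by rewrite addSnnS leq_add2l.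
by rewrite leqNgt addSn ltnS leq_addr /= -addSn addKn.
Qed.

Lemma ghostw_vers_low B (y : witt B n) k : (k <= m)%N -> ghostw (vers y) k = 0.
Proof.
move=> km; apply: big1 => i _; rewrite wcoef_vers_low; last first.
  by rewrite (leq_trans _ km) // -ltnS.
by rewrite expr0n gtn_eqF ?mulr0 // expn_gt0 q_gt0.
Qed.

Lemma ghostw_vers_high B (y : witt B n) k : (k <= n)%N ->
  ghostw (vers y) (m.+1 + k) = wpi B ^+ m.+1 * ghostw y k.
Proof.
move=> kn; rewrite /ghostw /ghost -addnS big_split_ord /= big1 ?add0r => [|i _].
  rewrite mulr_sumr; apply: eq_bigr => i _.
  rewrite wcoef_vers_high; last by rewrite (leq_trans _ kn) // -ltnS.
  by rewrite exprD subnDl mulrA.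
rewrite wcoef_vers_low; last by rewrite -ltnS.
by rewrite expr0n gtn_eqF ?mulr0 // expn_gt0 q_gt0.
Qed.

Lemma vers_map B C (f : rhom B C) (y : witt B n) :
  vers (wmap f y) = wmap f (vers y).
Proof.
apply/ffunP => i; rewrite !ffunE; case: ifP => _; first by rewrite rmorph0.
by rewrite wcoef_map.
Qed.

Lemma witt_shift_ghost_eq B (x y : witt B (m + n.+1)) : torsion_free B ->
  (forall k, (k <= m)%N -> ghostw x k = ghostw y k) ->
  (forall k, (k <= n)%N -> ghostw x (m.+1 + k) = ghostw y (m.+1 + k)) -> x = y.
Proof.
move=> tf lo hi; apply: (witt_ghost_eq tf) => k; have [km _|mk kmn] := leqP k m.
  exact: lo.
by rewrite -(subnKC mk); apply: hi; lia.
Qed.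

Lemma versD B (y y' : witt B n) : vers (y + y') = vers y + vers y'.
Proof.
have [A [f [x [x' [_ [tf -> -> _]]]]]] := witt_lift y y' y.
rewrite -wmapD !vers_map -wmapD; congr wmap.
apply: (witt_shift_ghost_eq tf) => k kn.
  have kmn : (k <= m + n.+1)%N by lia.
  by rewrite ghostwD // !ghostw_vers_low // addr0.
have kmn : (m.+1 + k <= m + n.+1)%N by lia.
by rewrite ghostwD // !ghostw_vers_high // ghostwD // mulrDr.
Qed.

Lemma vers0 B : vers (0 : witt B n) = 0.
Proof. by apply: (addIr (vers 0)); rewrite -versD !add0r. Qed.

(** After lifting to a torsion-free algebra it suffices to compare ghost components: both sides have
    zeros, then [pi^(2(m+1))] times the product of the components of [y] and [y']. The element [w]
    keeps its value in every component because phi fixes it. *)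
Lemma versM B (y y' : witt B n) :
  vers y * vers y' = vers (wstr B n (w ^+ m.+1) * y * y').
Proof.
have [A [f [x [x' [_ [tf -> -> _]]]]]] := witt_lift y y' y.
rewrite -(wstr_map n f) -!wmapM !vers_map -wmapM; congr wmap.
apply: (witt_shift_ghost_eq tf) => k kn.
  have kmn : (k <= m + n.+1)%N by lia.
  by rewrite ghostwM // !ghostw_vers_low // mul0r.
have kmn : (m.+1 + k <= m + n.+1)%N by lia.
rewrite ghostwM // !ghostw_vers_high // !ghostwM //.
by rewrite ghostw_wstr // iter_dphi_piX rmorphXn -/(wpi A); ring.
Qed.

(** The projection formula for Verschiebung. The ghost component [m + 1 + k] of [exp_delta r] is
    [phi^(m+1+k) r], which is component [k] for [phi^(m+1) r]. *)
Lemma wstr_vers B r (y : witt B n) :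
  wstr B (m + n.+1) r * vers y = vers (wstr B n (iter m.+1 (@dphi K S) r) * y).
Proof.
have [A [f [x [_ [_ [tf -> _ _]]]]]] := witt_lift y y y.
rewrite -!(wstr_map _ f) vers_map -!wmapM vers_map; congr wmap.
apply: (witt_shift_ghost_eq tf) => k kn.
  have kmn : (k <= m + n.+1)%N by lia.
  by rewrite ghostwM // !ghostw_vers_low // mulr0.
have kmn : (m.+1 + k <= m + n.+1)%N by lia.
rewrite ghostwM // !ghostw_vers_high // ghostwM // !ghostw_wstr //.
by rewrite addnC iterD; ring.
Qed.

Lemma vers_inj B : injective (@vers B).
Proof.
move=> y y' e; apply: witt_eq => i ile.
by rewrite -!wcoef_vers_high // e.
Qed.

Local Notation tr := (@trunc_rhom K S m (m + n.+1) (leq_addr n.+1 m)).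

Lemma trunc_vers B (y : witt B n) : tr B (vers y) = 0.
Proof.
apply: witt_eq => i ile; rewrite /= !wcoef_mk //; last exact: leq_trans (leq_addr _ _).
by rewrite ile.
Qed.

Lemma trunc_eq0 B (x : witt B (m + n.+1)) : tr B x = 0 -> exists y, x = vers y.
Proof.
move=> e; exists (wmk n (fun k => wcoef x (m.+1 + k))); apply: witt_eq => i ile.
have [im|mi] := leqP i m.
  rewrite wcoef_vers_low // -[LHS](wcoef_mk (wcoef x) im).
  by have := congr1 (fun z => wcoef z i) e; rewrite /= => ->; rewrite wcoef_mk.
rewrite -(subnKC mi) wcoef_vers_high ?wcoef_mk //; lia.
Qed.

Lemma trunc_surj B (z : witt B m) : exists x, tr B x = z.
Proof.
exists (wmk _ (wcoef z)); apply: witt_eq => i im.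
by rewrite /= !wcoef_mk // (leq_trans im) // leq_addr.
Qed.

End Verschiebung.

Lemma trunc_vers_comm m n n' (le_n : (n <= n')%N) (le_mn : (m + n.+1 <= m + n'.+1)%N)
    (B : ralg S) (y : witt B n') :
  trunc_rhom le_mn B (vers m y) = vers m (trunc_rhom le_n B y).
Proof.
apply: witt_eq => i ile; have ile' := leq_trans ile le_mn.
by rewrite /= !wcoef_mk //; case: ltnP => // mi; lia.
Qed.

Section FrobeniusComplements.
Variable n : nat.

Lemma frob_trunc (B : ralg S) (x : witt B n.+2) :
  frob_rhom n B (trunc_rhom (leqnSn n.+1) B x)
  = trunc_rhom (leqnSn n) (twist_ralg B) (frob_rhom n.+1 B x).
Proof.
rewrite /=; have [A [f [y [_ [_ [tf -> _ _]]]]]] := witt_lift x x x.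
rewrite wtrunc_map !wfrob_map wtrunc_map; congr wmap.
apply: (witt_ghost_eq (twist_tf tf)) => k kn.
have kn1 : (k <= n.+1)%N by exact: leqW.
by rewrite ghostw_frob // !ghostw_trunc // ghostw_frob.
Qed.

(** Modulo [pi^(k+1)] the ghost component [k + 1] of the generic vector is component [k] of its
    vector of q-th powers. The lower terms agree by induction, since raising to the power [q^(k-i)]
    improves a congruence modulo pi to one modulo [pi^(1+k-i)]. Finally [pi^k] is cancelled in the
    torsion-free polynomial ring. *)
Lemma wfrob_poly_congr k : (k <= n)%N ->
  congr_mod (wpi (mpoly_ralg S n.+2)) (wfrob_poly S n k) ('X_(inord k) ^+ q).
Proof.
set A := mpoly_ralg S n.+2; pose X i : A := 'X_(inord i : 'I_n.+2).
elim/ltn_ind: k => k IH kn.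
have [z] : congr_mod (wpi A ^+ k * wpi A) (wpi A ^+ k * wfrob_poly S n k)
    (wpi A ^+ k * X k ^+ q).
  pose F i := wfrob_poly S n i : A.
  have -> : wpi A ^+ k * F k = ghost F k - \sum_(i < k) wpi A ^+ i * F i ^+ (q ^ (k - i)).
    by rewrite ghostr addrC addKr.
  have -> : wpi A ^+ k * X k ^+ q = ghost (fun i => X i ^+ q) k
      - \sum_(i < k) wpi A ^+ i * (X i ^+ q) ^+ (q ^ (k - i)).
    by rewrite ghostr addrC addKr.
  apply: congrD; last apply: congrN.
    rewrite (wfrob_polyP S kn) ghostS -exprSr.
    rewrite -[X in congr_mod _ _ X]addr0; apply: congrD; first exact: congr_refl.
    exact: congr_mul0.
  apply: congr_sum => i _; have ik := ltn_ord i.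
  have -> : wpi A ^+ k * wpi A = wpi A ^+ i * wpi A ^+ (1 + (k - i)).
    by rewrite -exprD -exprSr; congr (_ ^+ _); lia.
  apply/congr_scale/congr_expq_iter => //; first exact: wpi_congr_q.
  by rewrite expr1; apply: IH => //; apply: leq_trans (ltnW ik) kn.
rewrite -mulrBr -mulrA => e; exists z.
exact: (torsion_freeX (k := k) (@mpoly_tf K S n.+2) e).
Qed.

Lemma wfrob_pi0 (B : calg S) (B0 : wpi B = 0) (x : witt B n.+1) :
  frob_rhom n B x
  = witt_rhom n (power_frob_rhom B0) (trunc_rhom (leqnSn n) B x).
Proof.
apply: (@witt_eq K S n (twist_ralg B)) => i ile; rewrite /= wcoef_mk //.
rewrite /witt_map wcoef_map wcoef_mk //= /power_frob.
have := congr_rmorph (mev_rhom (x : 'I_n.+2 -> B)) (wfrob_poly_congr ile).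
by rewrite rhom_wpi B0 rmorphXn => /congr_mod0 /= ->; rewrite mevX.
Qed.

End FrobeniusComplements.
End WittComplements.

(** * Transport of prolongation sequences *)

Lemma inj_surj_bijective (T U : Type) (f : T -> U) :
  injective f -> (forall y, exists x, f x = y) -> bijective f.
Proof.
move=> inj surj; exists (fun y => projT1 (cid (surj y))) => [x|y].
  by apply: inj; exact: projT2 (cid (surj (f x))).
exact: projT2 (cid (surj y)).
Qed.

(** The inverse of [1 - d * u] is the limit of its geometric series. *)
Lemma complete_unit (A : comPzRingType) (d u : A) :
  adically_complete d -> exists v, (1 - d * u) * v = 1.
Proof.
move=> cd; pose s k := \sum_(i < k) (d * u) ^+ i.
have [l hl] : exists l, forall k, congr_mod (d ^+ k) l (s k).
  apply: cd.2 => k; exists (u ^+ k).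
  by rewrite /s big_ord_recr /= addrAC subrr add0r exprMn.
exists l; apply: (adic_separated cd) => k.
apply: congr_trans (congrMl _ (hl k)) _; exists (- u ^+ k).
by rewrite /s -[1 - d * u]opprB mulNr -subrX1 exprMn; ring.
Qed.

(** If [E] contained no unit, all its elements would be divisible by the uniformizer, and so would
    1. *)
Lemma dvr_local (A : idomainType) (E : set A) : dvr A -> ideal_gen E 1 ->
  exists2 e, E e & e \is a GRing.unit.
Proof.
move=> [t [t0 tU ht]] E1; apply: contrapT => hE.
have [z] : congr_mod t 1 0.
  apply: (ideal_gen_sub (I := fun x => congr_mod t x 0)) E1.
    split=> [|x y hx hy|a x hx]; first exact: congr_refl.
      by rewrite -[0]addr0; apply: congrD.
    by rewrite -[0](mulr0 a); apply: congrMl.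
  move=> x Ex; have [->|/ht[u [[|k] [uU xE]]]] := eqVneq x 0; first exact: congr_refl.
    by case: hE; exists x; rewrite // xE mulr1.
  by exists (u * t ^+ k); rewrite subr0 xE exprS mulrCA.
rewrite subr0 => e; case/negP: tU; apply/unitrPr.
by exists z.
Qed.

Section Presheaves.
Variables (K : base_prime) (S : delta_dvr K).
Local Notation R := (dR S).
Local Notation w := (dpi S).

Lemma str_rhom_uniq (B : calg S) (s s' : rhom (base_calg S) B) : s = s'.
Proof. by apply: rhom_ext => r; rewrite -[r]/(str (base_ralg S) r) !rhom_str. Qed.

Lemma rhom_inverse (B C : ralg S) (h : rhom B C) (g : C -> B) :
  cancel h g -> cancel g h -> exists g' : rhom C B, g' =1 g.
Proof.
move=> hK gK; have inj := can_inj hK.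
have gB : zmod_morphism g by move=> x y; apply: inj; rewrite rmorphB !gK.
have gM : monoid_morphism g.
  by split=> [|x y]; apply: inj; rewrite ?rmorphM ?gK ?rmorph1.
have gS r : g (str C r) = str B r by apply: inj; rewrite gK rhom_str.
by exists (@RHom K S C B (HB.pack g (GRing.isZmodMorphism.Build C B g gB)
  (GRing.isMonoidMorphism.Build C B g gM) : {rmorphism C -> B}) gS).
Qed.

Lemma jet0_unit_iso (X : presheaf S) : is_iso (jet0_unit X).
Proof.
move=> B; have K1 : cancel (@witt0_rhom K S B) (fun x => ghostw x 0).
  by move=> b; rewrite /= ghostw_witt0.
have K2 : cancel (fun x => ghostw x 0) (@witt0_rhom K S B).
  by move=> x; rewrite /= -witt0_eq.
have [g gE] := rhom_inverse K1 K2.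
exists (@act K S X (witt_calg 0 B) B g) => x; rewrite /= /jet0_fun -act_comp.
  by rewrite -[RHS]act_id; congr act; apply: rhom_ext => b; rewrite /= gE K1.
rewrite -[RHS](@act_id K S X (witt_calg 0 B)); congr act; apply: rhom_ext => b.
by apply: etrans (K2 b); rewrite /= gE.
Qed.

Definition jet_mor n (X Y : presheaf S) (t : morphism X Y) :
    morphism (jet n X) (jet n Y) :=
  @Morphism K S (jet n X) (jet n Y) (fun B => t (witt_calg n B))
    (fun B C f x => @mor_act K S X Y t (witt_calg n B) (witt_calg n C) (witt_rhom n f) x).

Definition mcomp (X Y Z : presheaf S) (t : morphism Y Z)
    (s : morphism X Y) : morphism X Z.
refine (@Morphism K S X Z (fun B x => t B (s B x)) _).
by move=> B C f x; rewrite !mor_act.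
Defined.

Lemma iso_inverse (X Y : presheaf S) (t : morphism X Y) : is_iso t ->
  exists t' : morphism Y X,
    (forall B, cancel (t B) (t' B)) /\ (forall B, cancel (t' B) (t B)).
Proof.
move=> ht; have hg B : exists g : Y B -> X B, cancel (t B) g /\ cancel g (t B).
  by have [g] := ht B; exists g.
pose g B := projT1 (cid (hg B)).
have gP B : cancel (t B) (g B) /\ cancel (g B) (t B) by exact: projT2 (cid (hg B)).
have gact (B C : calg S) (f : rhom B C) y : g C (act f y) = act f (g B y).
  by rewrite -[y in LHS](gP B).2 -mor_act (gP C).1.
by exists (Morphism gact); split=> B; [exact: (gP B).1 | exact: (gP B).2].
Qed.

Lemma represents_iso_formal_scheme (X Y : presheaf S) (t : morphism X Y)
    (Q : calg S) (u : X Q) :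
  is_iso t -> represents u -> formal_scheme Y.
Proof.
move=> ht hu; apply: (@represents_formal_scheme K S Y Q (t Q u)) => B y.
have [t' [tK t'K]] := iso_inverse ht; have [h [hE uniq]] := hu B (t' B y).
exists h; split=> [|h' e]; first by rewrite -mor_act hE t'K.
by apply: uniq; rewrite -[LHS]tK mor_act e.
Qed.

Lemma jet_sequence_frob_proj (Y : presheaf S) n (B : calg S) (x : jet_sequence Y n.+2 B) :
  lfrob (jet_sequence Y) n B (lproj (jet_sequence Y) n.+1 B x)
  = lproj (jet_sequence Y) n (twist B) (lfrob (jet_sequence Y) n.+1 B x).
Proof.
rewrite /= /jet_frob_fun /jet_proj_fun -!act_comp; congr act.
by apply: rhom_ext => y; exact: frob_trunc.
Qed.

Lemma jet_sequence_frob_pi0 (Y : presheaf S) n (B : calg S) (B0 : wpi B = 0)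
    (x : jet_sequence Y n.+1 B) :
  lfrob (jet_sequence Y) n B x
  = @act K S (jet_sequence Y n) B (twist B) (power_frob_rhom B0)
      (lproj (jet_sequence Y) n B x).
Proof.
rewrite /= /jet_frob_fun /jet_proj_fun /jet_act -act_comp; congr act.
by apply: rhom_ext => y; exact: wfrob_pi0.
Qed.

Section Transport.
Variables (N : nat -> presheaf S) (pr : forall n, morphism (N n.+1) (N n)).
Variables (E : presheaf S) (e : forall n, morphism (jet n E) (N n)).
Hypothesis e_iso : forall n, is_iso (e n).
Hypothesis e_pr : forall n (B : calg S) (x : jet n.+1 E B),
  e n B (jet_proj (leqnSn n) E B x) = pr n B (e n.+1 B x).
Hypothesis N_formal : forall n, formal_scheme (N n).

Lemma transport_isos : exists t : forall n, morphism (N n) (jet n (N 0%N)),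
  [/\ forall n, is_iso (t n),
      forall (B : calg S) (x : N 0%N B), t 0%N B x = jet0_unit (N 0%N) B x &
      forall n (B : calg S) (x : N n.+1 B),
        t n B (pr n B x) = jet_proj (leqnSn n) (N 0%N) B (t n.+1 B x)].
Proof.
(* The isomorphisms are [J^n(eps)] after the inverse of [e n]. Taking [eps] through [J^0 E] is what
   makes the one of index 0 equal to [jet0_unit], by naturality. *)
pose eps := mcomp (e 0%N) (jet0_unit E).
have eps_iso : is_iso eps.
  by move=> B; apply: bij_comp; [exact: e_iso | exact: jet0_unit_iso].
pose e' n := projT1 (cid (iso_inverse (e_iso n))).
have [eK e'K] : (forall n B, cancel (e n B) (e' n B)) /\
    (forall n B, cancel (e' n B) (e n B)).
  by split=> n; have [] := projT2 (cid (iso_inverse (e_iso n))).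
exists (fun n => mcomp (jet_mor n eps) (e' n)); split=> [n B|B x|n B x].
- apply: bij_comp; first exact: eps_iso.
  by exists (e n B).
- have [y ->] : exists y, x = eps B y by have [g _ gK] := eps_iso B; exists (g x).
  rewrite /= eK; exact: (mor_act eps (witt0_rhom B : rhom B (witt_calg 0 B)) y).
- rewrite -[x in LHS]e'K -e_pr /= eK.
  exact: (mor_act eps (trunc_rhom (leqnSn n) B
    : rhom (witt_calg n.+1 B) (witt_calg n B)) _).
Qed.

(** The Frobenius lifts are pulled back from the jet sequence of [N 0] along the isomorphisms [t n].
    Each axiom is then checked after applying the injective [t n], where it becomes the axiom for
    jets. *)
Lemma transport_canonical : exists f : forall n, morphism (N n.+1) (frob_twist (N n)),
  is_canonical_prolongation_sequence (ProlongationData pr f).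
Proof.
have [t [t_iso t0 t_pr]] := transport_isos.
pose t' n := projT1 (cid (iso_inverse (t_iso n))).
have [tK t'K] : (forall n B, cancel (t n B) (t' n B)) /\
    (forall n B, cancel (t' n B) (t n B)).
  by split=> n; have [] := projT2 (cid (iso_inverse (t_iso n))).
have t_inj n B := can_inj (tK n B).
pose F n B (x : N n.+1 B) : frob_twist (N n) B :=
  t' n (twist B) (jet_frob n (N 0%N) B (t n.+1 B x)).
have tF n B (x : N n.+1 B) : t n (twist B) (F n B x) = jet_frob n (N 0%N) B (t n.+1 B x).
  exact: t'K.
have F_act n (B C : calg S) (h : rhom B C) (x : N n.+1 B) :
    F n C (act h x) = act h (F n B x).
  apply: (t_inj n (twist C)); rewrite tF mor_act mor_act.
  rewrite -tF; exact: esym (mor_act (t n) (twist_rhom h : rhom (twist B) (twist C)) _).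
exists (fun n => Morphism (F_act n)); split; last by exists t; split.
split=> [n|n B x|n B B0 x]; first exact: N_formal.
  apply: (t_inj n (twist B)); rewrite /= tF !t_pr tF.
  exact: jet_sequence_frob_proj.
apply: (t_inj n (twist B)); rewrite /= tF.
rewrite (mor_act (t n) (power_frob_rhom B0 : rhom B (twist B))) t_pr.
exact: jet_sequence_frob_pi0.
Qed.

End Transport.
End Presheaves.

(** * Points of the kernels *)

Section TwistedDifferences.
Variables (K : base_prime) (S : delta_dvr K).
Local Notation R := (dR S).
Local Notation w := (dpi S).
Variables (A : calg S) (p0 : rhom A (base_calg S)) (m : nat).

Definition phi_p0 (a : A) : R := iter m.+1 (@dphi K S) (p0 a).

(* These are the equations for a |-> exp_delta (p0 a) + V^(m+1) (y a) to be a
   homomorphism of algebras, since V^(m+1) y V^(m+1) z = pi^(m+1) V^(m+1) (y z)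
   and x V^(m+1) y = V^(m+1) (F^(m+1) x y). *)
Definition tdiff (C : ralg S) (y : A -> C) : Prop :=
  [/\ forall a b, y (a + b) = y a + y b,
      forall a b, y (a * b) = str C (phi_p0 a) * y b + str C (phi_p0 b) * y a
                              + str C (w ^+ m.+1) * y a * y b &
      forall r, y (str A r) = 0].

Lemma tdiff_rhom (C D : ralg S) (h : rhom C D) (y : A -> C) :
  tdiff y -> tdiff (fun a => h (y a)).
Proof.
case=> yD yM yS; split=> [a b|a b|r]; first by rewrite yD rmorphD.
  by rewrite yM !(rmorphD h) !(rmorphM h) !(rhom_str h).
by rewrite yS rmorph0.
Qed.

Definition tdiff_act (B C : calg S) (h : rhom B C) (y : {y : A -> B | tdiff y}) :
    {y : A -> C | tdiff y} :=
  exist _ (fun a => h (sval y a)) (tdiff_rhom h (svalP y)).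

Lemma tdiff_id (B : calg S) (y : {y : A -> B | tdiff y}) : tdiff_act (rid B) y = y.
Proof. by case: y => y hy; apply: eq_exist. Qed.

Lemma tdiff_comp (B C D : calg S) (g : rhom C D) (f : rhom B C)
  (y : {y : A -> B | tdiff y}) : tdiff_act (rcomp g f) y = tdiff_act g (tdiff_act f y).
Proof. exact: eq_exist. Qed.

Definition tdiffs : presheaf S :=
  @Presheaf K S (fun B => {y : A -> B | tdiff y}) tdiff_act tdiff_id tdiff_comp.

Definition jet_coord n (B : calg S) (y : jet n tdiffs B) (i : A * 'I_n.+1) : B :=
  (sval y i.1 : witt B n) i.2.

(** The coordinates of a point [y] are the Witt coordinates of all the [y a]; the conditions in
    [tdiff] are polynomial equations in them over [R]. *)
Lemma jet_tdiffs_represents n : exists (Q : calg S) (u : jet n tdiffs Q), represents u.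
Proof.
have [|||u hu] := @equational_represents K S (jet n tdiffs) _ (@jet_coord n).
- by move=> B C h x [a i]; rewrite /jet_coord /= /witt_map ffunE.
- move=> B [y hy] [y' hy'] e; apply: eq_exist; apply/funext => a.
  by apply/ffunP => i; have := e (a, i).
- move=> Q v sep; pose y a : witt_calg n Q := [ffun i => v (a, i)].
  suff hy : tdiff (y : A -> witt_ralg Q n).
    by exists (exist _ y hy : jet n tdiffs Q) => -[a i]; rewrite /jet_coord /= ffunE.
  (* Joint injectivity passes from [Q] to [W_n(Q)] coordinate by coordinate, so each identity of
     [tdiff] can be checked at actual points. *)
  have wsep (s t : witt Q n) : (forall (B : calg S) (h : rhom Q B) (x : jet n tdiffs B),
      (forall a, sval x a = witt_rhom n h (y a)) -> witt_rhom n h s = witt_rhom n h t)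
      -> s = t.
    move=> e; apply/ffunP => i; apply: sep => B h x hx.
    have /ffunP/(_ i) : witt_rhom n h s = witt_rhom n h t.
      apply: (e B h x) => a; apply/ffunP => k.
      by rewrite /= /witt_map !ffunE; apply: (hx (a, k)).
    by rewrite /= /witt_map !ffunE.
  split=> [a b|a b|r]; apply: wsep => B h [x [xD xM xS]] /= hx.
  + by rewrite -hx xD !hx -(rmorphD (witt_rhom n h)).
  + rewrite -hx xM !hx (rmorphD (witt_rhom n h)) (rmorphD (witt_rhom n h)).
    by rewrite !(rmorphM (witt_rhom n h)) !(rhom_str (witt_rhom n h)).
  + by rewrite -hx xS (rmorph0 (witt_rhom n h)).
by exists (tcalg (@jet_coord n)), u.
Qed.

Variables (n : nat) (B : calg S).
Local Notation W := (witt_calg (m + n.+1) B).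
Local Notation tr := (trunc_rhom (leq_addr n.+1 m) B).

Section ToHom.
Variable y : jet n tdiffs B.
Definition tdiff_hom_fun (a : A) : W :=
  wstr B (m + n.+1) (p0 a) + vers m (sval y a).

Lemma tdiff_hom_zmod : zmod_morphism tdiff_hom_fun.
Proof.
move=> a b; apply: (addIr (tdiff_hom_fun b)); rewrite subrK.
rewrite /tdiff_hom_fun addrACA -rmorphD -versD -rmorphD subrK.
by case: y => z [zD zM zS] /=; rewrite -[z _ + z _]zD subrK.
Qed.

Lemma tdiff_hom_monoid : monoid_morphism tdiff_hom_fun.
Proof.
rewrite /tdiff_hom_fun; case: y => z [zD zM zS] /=; split=> [|a b].
  by rewrite !rmorph1 -[X in z X](rmorph1 (str A)) zS vers0 addr0.
have vM t t' : vers m (str (witt_ralg B n) (w ^+ m.+1) * t * t')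
    = vers m t * vers m t'.
  exact: esym (versM _ _ _).
have vS c t : vers m (str (witt_ralg B n) (phi_p0 c) * t)
    = wstr B (m + n.+1) (p0 c) * vers m t.
  exact: esym (wstr_vers _ _ _).
by rewrite zM !versD vM !vS !rmorphM; ring.
Qed.

Lemma tdiff_hom_str r : tdiff_hom_fun (str A r) = str W r.
Proof.
rewrite /tdiff_hom_fun; case: y => z [zD zM zS] /=.
by rewrite zS vers0 addr0 rhom_str.
Qed.

Definition tdiff_hom : rhom A W :=
  @RHom K S A W (HB.pack tdiff_hom_fun
    (GRing.isZmodMorphism.Build A W tdiff_hom_fun tdiff_hom_zmod)
    (GRing.isMonoidMorphism.Build A W tdiff_hom_fun tdiff_hom_monoid)
    : {rmorphism A -> W}) tdiff_hom_str.

Lemma trunc_tdiff_hom a : tr (tdiff_hom a) = wstr B m (p0 a).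
Proof. by rewrite (rmorphD tr) trunc_vers addr0 (rhom_str tr). Qed.
End ToHom.

Lemma tdiff_hom_inj (y y' : jet n tdiffs B) : tdiff_hom y =1 tdiff_hom y' -> y = y'.
Proof.
case: y y' => [y hy] [y' hy'] e; apply: eq_exist; apply/funext => a.
by apply: (@vers_inj _ _ m); apply: addrI (e a).
Qed.

(** The difference between [g] and the structural part lies in the kernel of truncation, hence is
    [V^(m+1) y]. Additivity and multiplicativity of [g] become the equations on [y], as [V^(m+1)] is
    injective. *)
Lemma tdiff_hom_surj (g : rhom A W) : (forall a, tr (g a) = wstr B m (p0 a)) ->
  exists y : jet n tdiffs B, tdiff_hom y =1 g.
Proof.
move=> hg; have hv a : exists y : witt B n, g a - wstr B (m + n.+1) (p0 a) = vers m y.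
  by apply: trunc_eq0; rewrite rmorphB hg (rhom_str tr) subrr.
pose y a : witt_calg n B := projT1 (cid (hv a)).
have gE a : g a = wstr B (m + n.+1) (p0 a) + vers m (y a).
  by rewrite -(projT2 (cid (hv a))) addrC subrK.
suff hy : tdiff (y : A -> witt_ralg B n).
  by exists (exist _ y hy : jet n tdiffs B) => a; rewrite gE.
have vM t t' : vers m (str (witt_ralg B n) (w ^+ m.+1) * t * t')
    = vers m t * vers m t'.
  exact: esym (versM _ _ _).
have vS c t : vers m (str (witt_ralg B n) (phi_p0 c) * t)
    = wstr B (m + n.+1) (p0 c) * vers m t.
  exact: esym (wstr_vers _ _ _).
split=> [a b|a b|r]; apply: (@vers_inj K S m).
- rewrite versD; apply: (addrI (wstr B (m + n.+1) (p0 (a + b)))).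
  by rewrite -gE !rmorphD !gE; ring.
- rewrite !versD vM !vS; apply: (addrI (wstr B (m + n.+1) (p0 (a * b)))).
  by rewrite -gE !rmorphM !gE; ring.
apply: (addrI (wstr B (m + n.+1) (p0 (str A r)))); rewrite -gE.
by rewrite vers0 addr0 !rhom_str.
Qed.

End TwistedDifferences.

(** * Units and unit ideals lift along truncation of Witt vectors *)

Section Infinitesimal.
Variables (K : base_prime) (S : delta_dvr K) (m n : nat) (B : calg S).
Local Notation W := (witt_calg (m + n.+1) B).
Local Notation tr := (trunc_rhom (leq_addr n.+1 m) B).

(* An element V^(m+1) y of the kernel of truncation squares to
   pi^(m+1) V^(m+1) (y^2), so 1 + V^(m+1) y is invertible. *)
Lemma unit_of_trunc_eq1 (x : W) : tr x = 1 -> exists v, x * v = 1.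
Proof.
move=> e; have [y ey] : exists y, (x : witt B (m + n.+1)) - 1 = vers m y.
  by apply: trunc_eq0; rewrite (rmorphB tr) e (rmorph1 tr) subrr.
have xE : x = 1 + vers m y :> W by rewrite -ey addrC subrK.
pose t : W := wpi W ^+ m * (vers m (y * y) : W).
have sq : (vers m y : W) * vers m y = wpi W * t.
  rewrite /t mulrA -exprS wpiXE [LHS]versM -mulrA.
  by apply: esym; apply: etrans (wstr_vers _ _ _) _; rewrite iter_dphi_piX.
have [v hv] := complete_unit t (calg_complete W).
(* The product of [1 + vers m y] and [1 - vers m y] is [1 - pi * t], whose inverse is [v]. *)
exists ((1 - (vers m y : W)) * v); rewrite mulrA -[RHS]hv -sq xE; congr (_ * v).
by ring.
Qed.

(** Truncation is surjective, so a relation expressing 1 lifts to an element of the ideal of [D]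
    that truncates to 1; such an element is a unit. *)
Lemma ideal_gen_trunc (D : set W) :
  ideal_gen [set tr e | e in D] 1 -> ideal_gen D 1.
Proof.
move=> D1; have [x [Dx tx]] : exists x, ideal_gen D x /\ tr x = 1.
  apply: (ideal_gen_sub (I := fun z => exists x, ideal_gen D x /\ tr x = z)) D1.
    have [J0 JD JM] := ideal_gen_is_ideal D.
    split=> [|_ _ [x [Dx <-]] [y [Dy <-]]|a _ [x [Dx <-]]].
    - by exists 0; rewrite (rmorph0 tr).
    - by exists (x + y); split; [exact: JD | rewrite (rmorphD tr)].
    have [b <-] := trunc_surj n a.
    by exists (b * x); split; [exact: JM | rewrite (rmorphM tr)].
  by move=> _ [x Dx <-]; exists x; split=> //; apply: ideal_gen_mem.
have [v <-] := unit_of_trunc_eq1 tx; rewrite mulrC.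
by have [_ _ JM] := ideal_gen_is_ideal D; apply: JM.
Qed.

End Infinitesimal.

(** * The kernels of a marked formal scheme, computed in an affine chart *)

Section Kernel.
Variables (K : base_prime) (S : delta_dvr K).
Variables (X : presheaf S) (hX : formal_scheme X).
Variables (P0 : morphism (Spf (base_calg S)) X) (m : nat).

(** The open sets of [Spf R] induced by the cover generate the unit ideal, and [R] is local, so one
    of them is everything: that chart contains the marked point. A point over [W_(m+n+1)(B)] whose
    truncation lies in the chart lies in it too, because unit ideals lift along truncation. *)
Lemma marked_chart :
  exists (A : calg S) (j : morphism (Spf A) X) (p0 : rhom A (base_calg S)),
  [/\ forall B : calg S, injective (j B),
      j (base_calg S) p0 = P0 (base_calg S) (rid (base_calg S)) &
      forall n (B : calg S) (x : X (witt_calg (m + n.+1) B)),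
        (exists g, j (witt_calg m B) g = jet_proj (leq_addr n.+1 m) X B x) ->
        exists g, j (witt_calg (m + n.+1) B) g = x].
Proof.
have [_ [I [A [j [j_inj cov]]]]] := hX.
have [D [hD D1]] := cov (base_calg S) (P0 (base_calg S) (rid (base_calg S))).
have [d [i Did] dU] := dvr_local (dR_dvr S) D1.
have [p0 hp0] : exists p0 : rhom (A i) (base_calg S),
    j i (base_calg S) p0 = act (rid _) (P0 (base_calg S) (rid (base_calg S))).
  apply/(hD i (base_calg S) (rid _)); rewrite -(mulVr dU).
  have [_ _ JM] := ideal_gen_is_ideal [set rid (base_calg S) e | e in D i]%classic.
  by apply/JM/ideal_gen_mem; exists d.
exists (A i), (j i), p0; split=> [//||n B x hx]; first by rewrite hp0 act_id.
have [D' [hD' _]] := cov _ x.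
have := (hD' i _ (trunc_rhom (leq_addr n.+1 m) B
  : rhom (witt_calg (m + n.+1) B) (witt_calg m B))).1 hx.
move/ideal_gen_trunc => D'1.
have [|g hg] := (hD' i _ (rid (witt_calg (m + n.+1) B))).2; last first.
  by exists g; rewrite hg act_id.
move: D'1; congr ideal_gen; apply/funext => e; apply/propext.
by split=> [De|[e' De <-]//]; exists e.
Qed.

Section Chart.
Variables (A : calg S) (j : morphism (Spf A) X) (p0 : rhom A (base_calg S)).
Hypothesis j_inj : forall B : calg S, injective (j B).
Hypothesis j_p0 : j (base_calg S) p0 = P0 (base_calg S) (rid (base_calg S)).
Hypothesis j_lift : forall n (B : calg S) (x : X (witt_calg (m + n.+1) B)),
  (exists g, j (witt_calg m B) g = jet_proj (leq_addr n.+1 m) X B x) ->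
  exists g, j (witt_calg (m + n.+1) B) g = x.

(** There is only one homomorphism of [R]-algebras from [R] to [W_m(B)], so [exp_delta] followed by
    [W_m(s)] is the structure map. *)
Lemma marked_jetE (B : calg S) (s : Spf (base_calg S) B) :
  marked_jet P0 m B s
  = j (witt_calg m B) (rcomp (str_rhom (witt_calg m B) : rhom (base_calg S) _) p0).
Proof.
rewrite /= /marked_jet_fun; set s' := rcomp _ _.
have -> : s' = rcomp (str_rhom (witt_calg m B) : rhom (base_calg S) _) (rid _).
  exact: (@str_rhom_uniq K S (witt_calg m B)).
rewrite [LHS](mor_act P0 (str_rhom (witt_calg m B) : rhom (base_calg S) _) (rid _)).
by rewrite -j_p0 -(mor_act j).
Qed.

Lemma kernel_subproof n (B : calg S) (y : jet n (tdiffs p0 m) B) :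
  jet_proj (leq_addr n.+1 m) X B (j (witt_calg (m + n.+1) B) (tdiff_hom y))
  = marked_jet P0 m B (str_rhom B).
Proof.
rewrite marked_jetE /= /jet_proj_fun.
rewrite -(mor_act j (trunc_rhom (leq_addr n.+1 m) B
  : rhom (witt_calg (m + n.+1) B) (witt_calg m B))).
by congr (j _ _); apply: rhom_ext => a; exact: trunc_tdiff_hom.
Qed.

Definition kernel_of_tdiff n (B : calg S) (y : jet n (tdiffs p0 m) B) :
    Nspace P0 m n.+1 B :=
  exist (fun z : X (witt_calg (m + n.+1) B) * rhom (base_calg S) B =>
      jet_proj (leq_addr n.+1 m) X B z.1 = marked_jet P0 m B z.2)
    (j (witt_calg (m + n.+1) B) (tdiff_hom y), str_rhom B : rhom (base_calg S) B)
    (kernel_subproof y).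

Lemma kernel_of_tdiff_act n (B C : calg S) (f : rhom B C) (y : jet n (tdiffs p0 m) B) :
  kernel_of_tdiff (act f y) = act f (kernel_of_tdiff y).
Proof.
apply: eq_exist; congr pair; last exact: str_rhom_uniq.
rewrite [RHS]/= /jet_act -(mor_act j (witt_rhom (m + n.+1) f
  : rhom (witt_calg (m + n.+1) B) (witt_calg (m + n.+1) C))).
congr (j _ _); apply: rhom_ext => a.
rewrite [RHS]/= /witt_map wmapD wstr_map -vers_map.
by [].
Qed.

Definition kernel_iso n : morphism (jet n (tdiffs p0 m)) (Nspace P0 m n.+1) :=
  Morphism (@kernel_of_tdiff_act n).

(** For surjectivity, a point of the kernel truncates to the marked jet, which lies in the chart.
    Hence it is itself a homomorphism from [A], congruent to the structural one modulo the kernel of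
    truncation. *)
Lemma kernel_iso_iso n : is_iso (kernel_iso n).
Proof.
move=> B; apply: inj_surj_bijective => [y y' /(congr1 (fun z => (sval z).1)) e|].
  by apply: tdiff_hom_inj => a; rewrite (j_inj e).
move=> [[x s] /= e].
have [g gx] : exists g, j (witt_calg (m + n.+1) B) g = x.
  by apply: j_lift; eexists; exact: etrans (esym (marked_jetE s)) (esym e).
have [|y hy] := @tdiff_hom_surj K S A p0 m n B g.
  move=> a; have := etrans e (marked_jetE s); rewrite -gx /jet_proj_fun.
  rewrite -(mor_act j (trunc_rhom (leq_addr n.+1 m) B
    : rhom (witt_calg (m + n.+1) B) (witt_calg m B))).
  by move/j_inj => /(congr1 (fun h : rhom A (witt_calg m B) => h a)).
exists y; apply: eq_exist; congr pair; last exact: str_rhom_uniq.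
by rewrite -gx; congr (j _ _); apply: rhom_ext.
Qed.

Lemma kernel_iso_proj n (B : calg S) (y : jet n.+1 (tdiffs p0 m) B) :
  kernel_iso n B (jet_proj (leqnSn n) (tdiffs p0 m) B y)
  = Nspace_proj P0 m n.+1 B (kernel_iso n.+1 B y).
Proof.
apply: eq_exist; congr pair; rewrite /= /jet_proj_fun.
rewrite -(mor_act j (trunc_rhom (leq_add (leqnn m) (leqnSn n.+1)) B
  : rhom (witt_calg (m + n.+2) B) (witt_calg (m + n.+1) B))).
congr (j _ _); apply: rhom_ext => a; apply: esym.
set tr := trunc_rhom _ B.
apply: etrans (rmorphD tr _ _) _; congr (_ + _); first exact: (rhom_str tr).
exact: trunc_vers_comm.
Qed.

Lemma kernel_formal_scheme n : formal_scheme (Nspace P0 m n.+1).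
Proof.
have [Q [u hu]] := jet_tdiffs_represents p0 m n.
exact: (represents_iso_formal_scheme (@kernel_iso_iso n) hu).
Qed.

End Chart.
End Kernel.

Theorem theorem1p2 (K : base_prime) (S : delta_dvr K)
    (X : presheaf S) (hX : formal_scheme X)
    (P0 : morphism (Spf (base_calg S)) X) (m : nat) :
  (forall n : nat, (1 <= n)%N ->
     exists t : morphism (Nspace P0 m n) (jet n.-1 (Nspace P0 m 1)),
       is_iso t) /\
  (exists f : forall n : nat,
       morphism (Nspace P0 m n.+2) (frob_twist (Nspace P0 m n.+1)),
     is_canonical_prolongation_sequence (Nspace_sequence f)).
Proof.
have [A [j [p0 [j_inj j_p0 j_lift]]]] := marked_chart hX P0 m.
have e_iso := kernel_iso_iso j_inj j_p0 j_lift.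
have e_proj := @kernel_iso_proj K S X P0 m A j p0 j_p0.
split; last first.
  apply: (transport_canonical e_iso e_proj) => n.
  exact: (kernel_formal_scheme j_inj j_p0 j_lift).
have [t [t_iso _ _]] := transport_isos e_iso e_proj.
(* Index [n] of the sequence is the kernel of index [n + 1], which matches the jet order [n.-1] of
   the statement. *)
by case=> // n _; exists (t n).
Qed.
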